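(* Let $c,\theta\in\mathbb{R}_{>0}$ with $c+\theta=\pi$. Then the category $\mathcal{F}_c$ is a Frobenius category, whose indecomposable projective-injective objects are, up to isomorphism, the objects $E(x,x+\theta)\cong E(x+\theta,x+2\pi)$.
   Context: $R$ is a discrete valuation ring with uniformizing parameter $t$ and valuation $\nu$. $S^1=\mathbb{R}/2\pi\mathbb{Z}$, and for $x\in\mathbb{R}$ the class of $x$ in $S^1$ is $[x]$. A representation $V$ of $S^1$ over $R$ consists of an $R$-module $V[x]$ for every $[x]\in S^1$ and an $R$-linear map $V^{(x,\alpha)}:V[x]\to V[x-\alpha]$ for every $[x]\in S^1$ and real $\alpha\ge 0$ (depending only on $[x]$ and $\alpha$), such that $V^{(x-\beta,\alpha)}\circ V^{(x,\beta)}=V^{(x,\alpha+\beta)}$ for all $\alpha,\beta\ge 0$, and $V^{(x,2\pi n)}:V[x]\to V[x]$ is multiplication by $t^n$ for all $n\in\mathbb{N}$. A morphism $f:V\to W$ is a family of $R$-linear maps $f_{[x]}:V[x]\to W[x]$ with $W^{(x,\alpha)}f_{[x]}=f_{[x-\alpha]}V^{(x,\alpha)}$. Monomorphisms, epimorphisms, exactness and direct sums are taken pointwise; a representation is projective if morphisms from it lift through all epimorphisms. $P_{[x]}$ is the representation with $P_{[x]}[x-\alpha]=Re_x^\alpha$ free on one generator $e_x^\alpha$ for $0\le\alpha<2\pi$; for $n\in\mathbb{N}$ put $e_x^{\gamma+2\pi n}:=t^ne_x^\gamma$; write $e_x=e_x^0$; the structure maps are $P_{[x]}^{(x-\alpha,\beta)}(e_x^\alpha)=e_x^{\alpha+\beta}$.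 A representation is finitely generated if it is a quotient of a finite direct sum of representations $P_{[x_i]}$. $\mathcal{P}_{S^1}$ is the category of all finitely generated projective representations of $S^1$ over $R$; every object of it is isomorphic to a finite direct sum $\bigoplus P_{[x_i]}$. The category $\mathcal{F}_\pi$: objects are pairs $(V,d)$ with $V\in\mathcal{P}_{S^1}$ and $d:V\to V$ an endomorphism with $d^2=t$ (multiplication by $t$); morphisms $(V,d)\to(W,d)$ are morphisms $f:V\to W$ with $fd=df$. Exact sequences in $\mathcal{F}_\pi$ are the sequences $(X,d)\xrightarrow{f}(Y,d)\xrightarrow{g}(Z,d)$ such that $0\to X\xrightarrow{f}Y\xrightarrow{g}Z\to 0$ is exact (hence split exact) in $\mathcal{P}_{S^1}$. For real numbers $x\le y\le x+2\pi$ put $\alpha=y-x$, $\beta=x+2\pi-y$ and $E(x,y)=\left(P_{[x]}\oplus P_{[y]},\ d=\begin{bmatrix}0&\beta_*\\ \alpha_*&0\end{bmatrix}\right)\in\mathcal{F}_\pi$, where $\alpha_*(e_x)=e_y^\alpha$ and $\beta_*(e_y)=e_x^\beta$. Depth: for nonzero $f:P_{[x]}\to P_{[y]}$, the depth $\delta(f)$ is the unique real $\alpha\ge0$ with $f(e_x)=ue_y^\alpha$ for a unit $u\in R$; $\delta(0)=\infty$. For $f:\bigoplus_iP_{[x_i]}\to\bigoplus_jP_{[y_j]}$ with components $f_{ji}$, $\delta(f)=\min\delta(f_{ji})$ (independent of the decompositions). $\mathcal{F}_c$ is the full subcategory of $\mathcal{F}_\pi$ whose objects are all $(V,d)$ with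 $\delta(d)\ge\theta$. Its exact sequences are the exact sequences of $\mathcal{F}_\pi$ with all terms in $\mathcal{F}_c$. *)

(* Defs.v *)
From HB Require Import structures.
From mathcomp Require Import all_boot all_order all_algebra.
From mathcomp Require Import generic_quotient ring lra.
From mathcomp Require Import boolp classical_sets reals ereal trigo.

Set Implicit Arguments.
Unset Strict Implicit.
Unset Printing Implicit Defensive.

Import Order.TTheory GRing.Theory Num.Theory.

Local Open Scope ring_scope.
Local Open Scope quotient_scope.

(* [nu 0] is irrelevant: it plays the role of infinity. *)
Record is_dvr (R : idomainType) (nu : {fraction R} -> int) : Prop := IsDvr {
  dvrM : forall x y, x != 0 -> y != 0 -> nu (x * y) = nu x + nu y;
  dvrD : forall x y, x != 0 -> y != 0 -> x + y != 0 ->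
    Num.min (nu x) (nu y) <= nu (x + y);
  dvr_onto : forall k : int, exists2 x, x != 0 & nu x = k;
  dvr_ring : forall x, x != 0 -> (exists r : R, x = tofrac r) <-> 0 <= nu x
}.

Definition uniformizer (R : idomainType) (nu : {fraction R} -> int) (t : R) :=
  t != 0 /\ nu (tofrac t) = 1.

Record preadditive := Preadditive {
  obj :> Type;
  mor : obj -> obj -> zmodType;
  idm : forall X, mor X X;
  cmp : forall X Y Z, mor Y Z -> mor X Y -> mor X Z;
  cmpA : forall X Y Z W (h : mor Z W) (g : mor Y Z) (f : mor X Y),
    cmp h (cmp g f) = cmp (cmp h g) f;
  cmp1m : forall X Y (f : mor X Y), cmp (idm Y) f = f;
  cmpm1 : forall X Y (f : mor X Y), cmp f (idm X) = f;
  cmpDl : forall X Y Z (g g' : mor Y Z) (f : mor X Y),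
    cmp (g + g') f = cmp g f + cmp g' f;
  cmpDr : forall X Y Z (g : mor Y Z) (f f' : mor X Y),
    cmp g (f + f') = cmp g f + cmp g f'
}.

Arguments mor {p}.
Arguments idm {p}.
Arguments cmp {p X Y Z}.

Declare Scope cat_scope.
Delimit Scope cat_scope with cat.
Notation "g \c f" := (cmp g f) (at level 40, left associativity) : cat_scope.
Local Open Scope cat_scope.

Section Categories.
Variable C : preadditive.
Implicit Types X Y Z W A B : C.

Definition is_iso X Y (f : mor X Y) :=
  exists g : mor Y X, g \c f = idm X /\ f \c g = idm Y.

Definition isomorphic X Y := exists f : mor X Y, is_iso f.

Definition is_zero X := idm X = 0.

Definition is_biproduct A B X (i1 : mor A X) (i2 : mor B X)
    (p1 : mor X A) (p2 : mor X B) :=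
  [/\ p1 \c i1 = idm A, p2 \c i2 = idm B, p1 \c i2 = 0, p2 \c i1 = 0 &
      i1 \c p1 + i2 \c p2 = idm X].

Definition is_sum A B X := exists i1 i2 p1 p2, @is_biproduct A B X i1 i2 p1 p2.

Definition additive_category :=
  (exists X, is_zero X) /\ (forall A B, exists X, is_sum A B X).

Definition indecomposable X :=
  ~ is_zero X /\ forall A B, is_sum A B X -> is_zero A \/ is_zero B.

Definition is_kernel X Y Z (f : mor X Y) (g : mor Y Z) :=
  g \c f = 0 /\
  forall W (h : mor W Y), g \c h = 0 -> exists! k : mor W X, f \c k = h.

Definition is_cokernel X Y Z (f : mor X Y) (g : mor Y Z) :=
  g \c f = 0 /\
  forall W (h : mor Y W), h \c f = 0 -> exists! k : mor Z W, k \c g = h.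

Definition is_pullback P X Y Z (p : mor P X) (q : mor P Y)
    (f : mor X Z) (g : mor Y Z) :=
  f \c p = g \c q /\
  forall W (u : mor W X) (v : mor W Y), f \c u = g \c v ->
    exists! k : mor W P, p \c k = u /\ q \c k = v.

Definition is_pushout P X Y Z (p : mor X P) (q : mor Y P)
    (f : mor Z X) (g : mor Z Y) :=
  p \c f = q \c g /\
  forall W (u : mor X W) (v : mor Y W), u \c f = v \c g ->
    exists! k : mor P W, k \c p = u /\ k \c q = v.

Definition seq_class := forall X Y Z : C, mor X Y -> mor Y Z -> Prop.

Variable ex : seq_class.

Definition inflation X Y (f : mor X Y) := exists Z (g : mor Y Z), ex f g.
Definition deflation Y Z (g : mor Y Z) := exists X (f : mor X Y), ex f g.

(* Quillen's axioms, in their self-dual form. *)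
Record exact_category : Prop := ExactCategory {
  exact_additive : additive_category;
  exact_kernel : forall X Y Z (f : mor X Y) (g : mor Y Z),
    ex f g -> is_kernel f g /\ is_cokernel f g;
  exact_iso : forall X Y Z X' Y' Z' (f : mor X Y) (g : mor Y Z)
      (f' : mor X' Y') (g' : mor Y' Z')
      (a : mor X X') (b : mor Y Y') (c : mor Z Z'),
    is_iso a -> is_iso b -> is_iso c ->
    f' \c a = b \c f -> g' \c b = c \c g -> ex f g -> ex f' g';
  exact_infl1 : forall X, inflation (idm X);
  exact_defl1 : forall X, deflation (idm X);
  exact_inflM : forall X Y Z (g : mor Y Z) (f : mor X Y),
    inflation f -> inflation g -> inflation (g \c f);
  exact_deflM : forall X Y Z (g : mor Y Z) (f : mor X Y),
    deflation f -> deflation g -> deflation (g \c f);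
  exact_pushout : forall Z X Y (f : mor Z X) (g : mor Z Y), inflation f ->
    exists P (p : mor X P) (q : mor Y P), is_pushout p q f g /\ inflation q;
  exact_pullback : forall X Y Z (f : mor X Z) (g : mor Y Z), deflation f ->
    exists P (p : mor P X) (q : mor P Y), is_pullback p q f g /\ deflation q
}.

Definition projective_object P := forall Y Z (g : mor Y Z) (h : mor P Z),
  deflation g -> exists k : mor P Y, g \c k = h.

Definition injective_object I := forall X Y (f : mor X Y) (h : mor X I),
  inflation f -> exists k : mor Y I, k \c f = h.

Definition enough_projectives :=
  forall X, exists P (g : mor P X), projective_object P /\ deflation g.

Definition enough_injectives :=
  forall X, exists I (f : mor X I), injective_object I /\ inflation f.

Definition frobenius :=
  [/\ exact_category, enough_projectives, enough_injectives &
      forall X, projective_object X <-> injective_object X].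

End Categories.

Arguments seq_class : clear implicits.

Program Definition full_subcategory (C : preadditive) (p : C -> Prop) : preadditive :=
  @Preadditive {X : C | p X} (fun X Y => mor (sval X) (sval Y))
    (fun X => idm (sval X)) (fun X Y Z g f => g \c f) _ _ _ _ _.
Next Obligation. by move=> *; apply: cmpA. Qed.
Next Obligation. by move=> *; apply: cmp1m. Qed.
Next Obligation. by move=> *; apply: cmpm1. Qed.
Next Obligation. by move=> *; apply: cmpDl. Qed.
Next Obligation. by move=> *; apply: cmpDr. Qed.

Section Circle.
Variable Re : realType.
Implicit Types x y alpha beta : Re.

Definition tau : Re := 2 * pi.

Lemma tau_gt0 : 0 < tau.
Proof. by rewrite mulr_gt0 ?pi_gt0. Qed.

Definition circle_rel x y := (x - y) / tau \is a Num.int.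

Lemma circle_rel_refl : reflexive circle_rel.
Proof. by move=> x; rewrite /circle_rel subrr mul0r rpred0. Qed.

Lemma circle_rel_sym : symmetric circle_rel.
Proof. by move=> x y; rewrite /circle_rel -opprB mulNr rpredN. Qed.

Lemma circle_rel_trans : transitive circle_rel.
Proof.
move=> y x z xy yz; rewrite /circle_rel -(subrK y x) -addrA mulrDl.
exact: rpredD.
Qed.

Canonical circle_equiv :=
  EquivRel circle_rel circle_rel_refl circle_rel_sym circle_rel_trans.

Definition circle := {eq_quot circle_equiv}.
HB.instance Definition _ := Choice.on circle.
HB.instance Definition _ := EqQuotient.on circle.

Definition cls x : circle := \pi_circle x.

Lemma cls_eq x y : cls x = cls y <-> circle_rel x y.
Proof. by split=> [/eqquotP|h]; [|apply/eqquotP]. Qed.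

Lemma cls_repr (a : circle) : cls (repr a) = a.
Proof. exact: reprK. Qed.

(* The point of the circle reached from [a] by going back by [alpha]. *)
Definition rot (a : circle) alpha : circle := cls (repr a - alpha).

Lemma rot_cls x alpha : rot (cls x) alpha = cls (x - alpha).
Proof.
apply/cls_eq; have /cls_eq := cls_repr (cls x); rewrite /circle_rel.
by congr (_ \is a _); ring.
Qed.

Lemma rotD (a : circle) alpha beta : rot (rot a alpha) beta = rot a (alpha + beta).
Proof. by rewrite [rot a alpha]/rot rot_cls /rot opprD addrA. Qed.

(* [arc a b alpha] : alpha >= 0 and b = a - alpha in the circle.  Structure
   maps V[a] -> V[b] are indexed by such triples, which avoids transporting
   along equalities such as (a - alpha) - beta = a - (alpha + beta). *)
Definition arc (a b : circle) alpha := (0 <= alpha) && (b == rot a alpha).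

Lemma arc_cls x alpha : 0 <= alpha -> arc (cls x) (cls (x - alpha)) alpha.
Proof. by move=> h; rewrite /arc h rot_cls eqxx. Qed.

Lemma arc0 (a : circle) : arc a a 0.
Proof. by rewrite /arc lexx /rot subr0 cls_repr eqxx. Qed.

Lemma arcD (a b c : circle) alpha beta :
  arc a b alpha -> arc b c beta -> arc a c (alpha + beta).
Proof.
move=> /andP[a0 /eqP->] /andP[b0 /eqP->].
by rewrite /arc addr_ge0 //= rotD.
Qed.

(* For x >= 0, x = rem2pi x + 2 pi * turns x with 0 <= rem2pi x < 2 pi. *)
Definition turns x : nat := Num.truncn (x / tau).
Definition rem2pi x : Re := x - tau * (Num.floor (x / tau))%:~R.

Lemma rem2pi_ge0 x : 0 <= rem2pi x.
Proof.
rewrite subr_ge0 mulrC -ler_pdivlMr ?tau_gt0 //.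
exact: floor_le.
Qed.

Lemma rem2pi_lt x : rem2pi x < tau.
Proof.
have := floorD1_gt (x / tau); rewrite ltr_pdivrMr ?tau_gt0 // intrD mulrDl.
by rewrite mul1r ltrBlDl [tau * _]mulrC.
Qed.

(* The unique real 0 <= gamma < 2 pi with b = a - gamma. *)
Definition dist (a b : circle) : Re := rem2pi (repr a - repr b).

Lemma dist_ge0 a b : 0 <= dist a b. Proof. exact: rem2pi_ge0. Qed.

Lemma dist_lt a b : dist a b < tau. Proof. exact: rem2pi_lt. Qed.

Lemma arc_dist a b : arc a b (dist a b).
Proof.
rewrite /arc rem2pi_ge0 /= -{1}(cls_repr b); apply/eqP/cls_eq.
rewrite /circle_rel /dist /rem2pi; set k := Num.floor _.
have -> : repr b - (repr a - (repr a - repr b - tau * k%:~R)) =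
  - k%:~R * tau by ring.
by rewrite mulfK ?rpredN ?intr_int // gt_eqF // tau_gt0.
Qed.

Lemma turnsD x n : 0 <= x -> turns (x + tau * n%:R) = (turns x + n)%N.
Proof.
move=> x0; rewrite /turns mulrDl mulrAC mulfV ?gt_eqF ?tau_gt0 // mul1r.
have d0 : 0 <= x / tau by rewrite divr_ge0 // ltW // tau_gt0.
by rewrite addrC truncnD ?nnegrE ?natr_nat // natrK addnC.
Qed.

Lemma turns0 x : 0 <= x < tau -> turns x = 0%N.
Proof.
move=> /andP[x0 xt]; apply: truncn_def.
have t0 := tau_gt0; apply/andP; split; first by rewrite divr_ge0 // ltW.
by rewrite ltr_pdivrMr // mul1r.
Qed.

Lemma arc_turns a b alpha :
  arc a b alpha -> alpha = dist a b + tau * (turns alpha)%:R.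
Proof.
move=> /andP[alpha0 /eqP bE].
have /andP[g0 /eqP] := arc_dist a b; rewrite {1}bE => /cls_eq.
rewrite /circle_rel; have -> : repr a - alpha - (repr a - dist a b) =
  dist a b - alpha by ring.
move=> /intrP[k kE]; have t0 := tau_gt0.
have {}kE : alpha = dist a b + tau * (- k)%:~R.
  by rewrite intrN -kE mulrN mulrC mulfVK ?gt_eqF //; ring.
have gt : dist a b < tau by exact: rem2pi_lt.
move: kE; case: (- k) => n kE; last first.
  move: alpha0; rewrite kE NegzE mulrNz mulrN subr_ge0 leNgt.
  by rewrite (lt_le_trans gt) // ler_peMr ?(ltW t0) // -pmulrn ler1n.
by rewrite {2}kE turnsD // turns0 ?add0n ?g0.
Qed.

End Circle.

Section DependentProduct.
Variables (R : pzRingType) (I : Type) (M : I -> lmodType R).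

Definition dprod := forall i, M i.
Implicit Types f g : dprod.

HB.instance Definition _ := gen_eqMixin dprod.
HB.instance Definition _ := gen_choiceMixin dprod.

Definition dprod_zero : dprod := fun=> 0.
Definition dprod_opp f : dprod := fun i => - f i.
Definition dprod_add f g : dprod := fun i => f i + g i.
Definition dprod_scale (k : R) f : dprod := fun i => k *: f i.

Let ext f g : (forall i, f i = g i) -> f = g.
Proof. exact: functional_extensionality_dep. Qed.

Let addA : associative dprod_add.
Proof. by move=> f g h; apply: ext => i; apply: addrA. Qed.
Let addC : commutative dprod_add.
Proof. by move=> f g; apply: ext => i; apply: addrC. Qed.
Let add0 : left_id dprod_zero dprod_add.
Proof. by move=> f; apply: ext => i; apply: add0r. Qed.
Let addN : left_inverse dprod_zero dprod_opp dprod_add.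
Proof. by move=> f; apply: ext => i; apply: addNr. Qed.

HB.instance Definition _ := GRing.isZmodule.Build dprod addA addC add0 addN.

Let scaleA k l f : dprod_scale k (dprod_scale l f) = dprod_scale (k * l) f.
Proof. by apply: ext => i; apply: scalerA. Qed.
Let scale1 : left_id 1 dprod_scale.
Proof. by move=> f; apply: ext => i; apply: scale1r. Qed.
Let scaleDr : right_distributive dprod_scale +%R.
Proof. by move=> k f g; apply: ext => i; apply: scalerDr. Qed.
Let scaleDl f : {morph dprod_scale^~ f : k l / k + l}.
Proof. by move=> k l; apply: ext => i; apply: scalerDl. Qed.

HB.instance Definition _ :=
  GRing.Zmodule_isLmodule.Build R dprod scaleA scale1 scaleDr scaleDl.

Lemma dprod_sumE (J : Type) (s : seq J) (P : pred J) (F : J -> dprod) i :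
  (\sum_(j <- s | P j) F j) i = \sum_(j <- s | P j) F j i.
Proof. by elim/big_rec2: _ => // j x y _ <-. Qed.

End DependentProduct.

Section Representations.
Variables (Re : realType) (R : idomainType) (t : R).
Local Notation S1 := (circle Re).
Implicit Types (a b c : S1) (alpha beta : Re).

Record rep := Rep {
  rep_mod :> S1 -> lmodType R;
  rep_map : forall a b alpha, arc a b alpha ->
    {linear rep_mod a -> rep_mod b};
  rep_comp : forall a b c beta alpha
      (hb : arc a b beta) (ha : arc b c alpha) (h : arc a c (alpha + beta)) v,
    rep_map ha (rep_map hb v) = rep_map h v;
  rep_turn : forall a n (h : arc a a (tau Re * n%:R)) v,
    rep_map h v = t ^+ n *: v
}.

Record hom (V W : rep) := Hom {
  hom_fun :> forall a, {linear V a -> W a};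
  hom_nat : forall a b alpha (h : arc a b alpha) v,
    rep_map W h (hom_fun a v) = hom_fun b (rep_map V h v)
}.

Lemma linear_ext (U V : lmodType R) (f g : {linear U -> V}) :
  f =1 g -> f = g.
Proof.
case: f g => [f [[cf] [cf']]] [g [[cg] [cg']]] /= /funext fg.
case: _ / fg cg cg' => cg cg'.
by rewrite (Prop_irrelevance cf cg) (Prop_irrelevance cf' cg').
Qed.

Lemma hom_ext V W (f g : hom V W) : (forall a v, f a v = g a v) -> f = g.
Proof.
case: f g => [f nf] [g ng] /= fg.
have {}fg : f = g.
  by apply: functional_extensionality_dep => a; apply/linear_ext/fg.
by case: _ / fg ng => ng; rewrite (Prop_irrelevance nf ng).
Qed.

HB.instance Definition _ V W := gen_eqMixin (hom V W).
HB.instance Definition _ V W := gen_choiceMixin (hom V W).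

Section HomGroup.
Variables V W : rep.
Implicit Types f g : hom V W.

Program Definition hom_zero : hom V W := @Hom V W (fun a => \0) _.
Next Obligation. move=> * /=; exact: linear0. Qed.

Program Definition hom_opp f : hom V W := @Hom V W (fun a => \- f a) _.
Next Obligation. by move=> * /=; rewrite linearN /= hom_nat. Qed.

Program Definition hom_add f g : hom V W := @Hom V W (fun a => f a \+ g a) _.
Next Obligation. by move=> * /=; rewrite linearD /= !hom_nat. Qed.

Let addA : associative hom_add.
Proof. by move=> f g h; apply: hom_ext => a v; apply: addrA. Qed.
Let addC : commutative hom_add.
Proof. by move=> f g; apply: hom_ext => a v; apply: addrC. Qed.
Let add0 : left_id hom_zero hom_add.
Proof. by move=> f; apply: hom_ext => a v; apply: add0r. Qed.
Let addN : left_inverse hom_zero hom_opp hom_add.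
Proof. by move=> f; apply: hom_ext => a v; apply: addNr. Qed.

HB.instance Definition _ := GRing.isZmodule.Build (hom V W) addA addC add0 addN.

End HomGroup.

Program Definition hom_id V : hom V V := @Hom V V (fun a => idfun) _.
Next Obligation. by []. Qed.

Program Definition hom_comp V W X (g : hom W X) (f : hom V W) : hom V X :=
  @Hom V X (fun a => g a \o f a) _.
Next Obligation. by move=> * /=; rewrite !hom_nat. Qed.

Program Definition Rep_cat : preadditive :=
  @Preadditive rep (fun V W => hom V W) hom_id hom_comp _ _ _ _ _.
Next Obligation. by move=> *; apply: hom_ext. Qed.
Next Obligation. by move=> *; apply: hom_ext. Qed.
Next Obligation. by move=> *; apply: hom_ext. Qed.
Next Obligation. by move=> *; apply: hom_ext. Qed.
Next Obligation. by move=> *; apply: hom_ext => a v /=; rewrite linearD. Qed.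

Definition mono V W (f : hom V W) := forall a, injective (f a).
Definition epi V W (f : hom V W) := forall a w, exists v, f a v = w.
Definition exact_at V W X (f : hom V W) (g : hom W X) :=
  forall a w, g a w = 0 <-> exists v, f a v = w.
Definition short_exact V W X (f : hom V W) (g : hom W X) :=
  [/\ mono f, exact_at f g & epi g].

Definition rep_projective P := forall V W (g : hom V W) (h : hom P W),
  epi g -> exists k : hom P V, hom_comp g k = h.

Section DirectSum.
Variables (I : finType) (V : I -> rep).

Definition dsum_map a b alpha (h : arc a b alpha)
    (v : dprod (fun i => V i a)) : dprod (fun i => V i b) :=
  fun i => rep_map (V i) h (v i).

Lemma dsum_map_linear a b alpha h : linear (@dsum_map a b alpha h).
Proof.
by move=> k u v; apply: functional_extensionality_dep => i; apply: linearP.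
Qed.

HB.instance Definition _ a b alpha (h : arc a b alpha) :=
  GRing.isLinear.Build R (dprod (fun i => V i a)) (dprod (fun i => V i b)) _
    (dsum_map h) (dsum_map_linear h).

Program Definition dsum : rep :=
  @Rep (fun a => dprod (fun i => V i a)) (fun a b alpha h => dsum_map h) _ _.
Next Obligation.
by move=> *; apply: functional_extensionality_dep => i; apply: rep_comp.
Qed.
Next Obligation.
by move=> *; apply: functional_extensionality_dep => i; apply: rep_turn.
Qed.

Definition dsum_in_fun i a (v : V i a) : dsum a :=
  dfwith (fun j => 0 : V j a) v.

Lemma dsum_in_linear i a : linear (@dsum_in_fun i a).
Proof.
move=> k u v; apply: functional_extensionality_dep => j.
suff -> : (k *: dsum_in_fun u + dsum_in_fun v) j =
  k *: (dsum_in_fun u j : V j a) + dsum_in_fun v j :> V j a.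
  rewrite /dsum_in_fun.
  have [<-|ij] := eqVneq i j; first by rewrite !dfwith_in.
  by rewrite !dfwith_out // scaler0 addr0.
by [].
Qed.

HB.instance Definition _ i a :=
  GRing.isLinear.Build R (V i a) (dsum a) _ (@dsum_in_fun i a)
    (@dsum_in_linear i a).

Program Definition dsum_in i : hom (V i) dsum :=
  @Hom (V i) dsum (@dsum_in_fun i) _.
Next Obligation.
move=> i a b alpha h v; apply: functional_extensionality_dep => j; rewrite /= /dsum_map /dsum_in_fun.
have [<-|ij] := eqVneq i j; first by rewrite !dfwith_in.
by rewrite !dfwith_out // linear0.
Qed.

Definition dsum_out_fun i a (v : dsum a) : V i a := v i.

Lemma dsum_out_linear i a : linear (@dsum_out_fun i a).
Proof. by []. Qed.

HB.instance Definition _ i a :=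
  GRing.isLinear.Build R (dsum a) (V i a) _ (@dsum_out_fun i a)
    (@dsum_out_linear i a).

Program Definition dsum_out i : hom dsum (V i) :=
  @Hom dsum (V i) (@dsum_out_fun i) _.
Next Obligation. by []. Qed.

End DirectSum.

Lemma hom_sumE V W (I : Type) (s : seq I) (p : pred I) (F : I -> hom V W) a v :
  (\sum_(i <- s | p i) F i) a v = \sum_(i <- s | p i) F i a v.
Proof. by elim/big_rec2: _ => // i x y _ <-. Qed.

(* The morphism of direct sums with matrix F, the entry F j i being the
   component from the i-th to the j-th summand. *)
Definition mxhom (I J : finType) (V : I -> rep) (W : J -> rep)
    (F : forall j i, hom (V i) (W j)) : hom (dsum V) (dsum W) :=
  \sum_j \sum_i hom_comp (dsum_in W j) (hom_comp (F j i) (dsum_out V i)).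

Lemma mxhomE (I J : finType) (V : I -> rep) (W : J -> rep)
    (F : forall j i, hom (V i) (W j)) a (v : dsum V a) j :
  mxhom F a v j = \sum_i F j i a (v i).
Proof.
rewrite hom_sumE dprod_sumE (bigD1 j) //= [X in _ + X]big1 ?addr0.
  rewrite hom_sumE dprod_sumE; apply: eq_bigr => i _ /=.
  by rewrite /dsum_in_fun dfwith_in.
move=> k kj; rewrite hom_sumE dprod_sumE big1 // => i _ /=.
by rewrite /dsum_in_fun dfwith_out.
Qed.

Lemma rep_map_turns (V : rep) a b alpha (h : arc a b alpha) v :
  rep_map V h v = t ^+ turns alpha *: rep_map V (arc_dist a b) v.
Proof.
have hb : arc b b (tau Re * (turns alpha)%:R).
  rewrite /arc mulr_ge0 ?ler0n ?(ltW (tau_gt0 _)) //=.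
  rewrite -{1}(cls_repr b); apply/eqP/cls_eq; rewrite /circle_rel.
  have -> : repr b - (repr b - tau Re * (turns alpha)%:R) =
    (turns alpha)%:R * tau Re by ring.
  by rewrite mulfK ?natr_int // gt_eqF ?tau_gt0.
have e : alpha = tau Re * (turns alpha)%:R + dist a b.
  by rewrite addrC; exact: arc_turns h.
have h' : arc a b (tau Re * (turns alpha)%:R + dist a b) by rewrite -e.
rewrite -(rep_turn hb) (rep_comp _ _ h'); move: h h'; rewrite -e => h h'.
by rewrite (Prop_irrelevance h h').
Qed.

Definition P_map (n : nat) (r : R^o) : R^o := t ^+ n * r.

Lemma P_map_linear n : linear (P_map n).
Proof. by move=> k u v; rewrite /P_map mulrDr [t ^+ n * _]mulrCA. Qed.

HB.instance Definition _ n :=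
  GRing.isLinear.Build R R^o R^o _ (P_map n) (P_map_linear n).

Lemma turns_dist a b c beta alpha : arc b c beta -> 0 <= alpha ->
  turns (dist a b + (alpha + beta)) =
  (turns (dist a c + alpha) + turns (dist a b + beta))%N.
Proof.
move=> h a0; rewrite -turnsD; last by rewrite (addr_ge0 (dist_ge0 _ _)).
congr (turns _).
by rewrite addrCA [in LHS](arc_turns (arcD (arc_dist a b) h)); ring.
Qed.

(* P a b is the free module on e_a^gamma, where gamma = dist a b. *)
Program Definition P a : rep :=
  @Rep (fun=> R^o) (fun b c beta h => P_map (turns (dist a b + beta))) _ _.
Next Obligation.
move=> a b c b' beta alpha hb /andP[ha _] h v /=.
by rewrite /P_map mulrA -exprD -turns_dist.
Qed.
Next Obligation.
move=> a b n h v /=.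
by rewrite /P_map turnsD ?dist_ge0 // turns0 // dist_ge0 dist_lt.
Qed.

(* The element e_a^alpha of P_[a][a - alpha], for an arbitrary alpha >= 0. *)
Definition e_ a b alpha (h : arc a b alpha) : P a b := t ^+ turns alpha.

Lemma e_gen a b alpha (h : arc a b alpha) (r : P a b) :
  alpha < tau Re -> r = (r : R) *: e_ h.
Proof.
move=> lt; rewrite /e_ turns0 ?lt ?andbT; last by case/andP: h.
by rewrite expr0 -[LHS]mulr1.
Qed.

Lemma e_turn a b alpha n (h : arc a b alpha)
    (h' : arc a b (alpha + tau Re * n%:R)) : e_ h' = t ^+ n *: e_ h.
Proof.
have a0 : 0 <= alpha by case/andP: h.
by rewrite /e_ (turnsD n a0) addnC exprD.
Qed.

Lemma e_map a b c alpha beta (h : arc a b alpha) (h' : arc b c beta) :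
  rep_map (P a) h' (e_ h) = e_ (arcD h h').
Proof.
rewrite /= /P_map /e_ -exprD; congr (_ ^+ _).
have -> : alpha + beta = dist a b + beta + tau Re * (turns alpha)%:R.
  by rewrite {1}(arc_turns h); ring.
have b0 : 0 <= dist a b + beta.
  by case/andP: h' => b0 _; exact: addr_ge0 (dist_ge0 _ _) b0.
by rewrite (turnsD _ b0).
Qed.

(* The morphism P_[a] -> V sending e_a to v. *)
Definition P_hom_fun (V : rep) a (v : V a) b (r : P a b) : V b :=
  (r : R) *: rep_map V (arc_dist a b) v.

Lemma P_hom_linear (V : rep) a (v : V a) b : linear (@P_hom_fun V a v b).
Proof. by move=> k u w; rewrite /P_hom_fun scalerDl scalerA. Qed.

HB.instance Definition _ (V : rep) a (v : V a) b :=
  GRing.isLinear.Build R (P a b) (V b) _ (@P_hom_fun V a v b)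
    (@P_hom_linear V a v b).

Program Definition P_hom (V : rep) a (v : V a) : hom (P a) V :=
  @Hom (P a) V (@P_hom_fun V a v) _.
Next Obligation.
move=> V a v b c alpha h r; rewrite /= /P_hom_fun linearZ /=.
have h' : arc a c (alpha + dist a b).
  by rewrite addrC; exact: arcD (arc_dist a b) h.
by rewrite (rep_comp _ _ h') rep_map_turns scalerA /P_map mulrC addrC.
Qed.

Lemma P_homE (V : rep) a (v : V a) : P_hom v a (e_ (arc0 a)) = v.
Proof.
rewrite /= /P_hom_fun /e_.
have := rep_map_turns (arc0 a) v => <-.
have h0 : arc a a (tau Re * 0%:R) by rewrite mulr0; exact: arc0.
have := rep_turn h0 v; rewrite expr0 scale1r.
move: (arc0 a) h0; rewrite mulr0 => h h'; by rewrite (Prop_irrelevance h h').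
Qed.

Lemma P_hom_inj (V : rep) a (f g : hom (P a) V) :
  f a (e_ (arc0 a)) = g a (e_ (arc0 a)) -> f = g.
Proof.
move=> fg; apply: hom_ext => b r.
have lt : dist a b < tau Re by exact: dist_lt.
have -> : r = (r : R) *: rep_map (P a) (arc_dist a b) (e_ (arc0 a)).
  rewrite e_map; apply: e_gen; by rewrite add0r.
have fE (k : hom (P a) V) : k b ((r : R) *: rep_map (P a) (arc_dist a b) (e_ (arc0 a))) =
    (r : R) *: rep_map V (arc_dist a b) (k a (e_ (arc0 a))).
  by rewrite hom_nat; exact: linearZ.
by rewrite !fE fg.
Qed.

Lemma P_hom_e a b c alpha beta (h : arc a b alpha) (h' : arc b c beta) :
  P_hom (e_ h) c (e_ h') = e_ (arcD h h').
Proof.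
rewrite -[RHS]e_map -[e_ h in RHS](P_homE (e_ h)) hom_nat e_map.
by rewrite /e_ add0r.
Qed.

Lemma P_hom_t a b alpha beta (h : arc a b alpha) (h' : arc b a beta) c r :
  alpha + beta = tau Re -> P_hom (e_ h) c (P_hom (e_ h') c r) = t *: r.
Proof.
move=> ab; have lt : dist a c < tau Re by exact: rem2pi_lt.
have L (V W : rep) (f : hom V W) (k : R) (v : V c) : f c (k *: v) = k *: f c v.
  exact: linearZ.
rewrite [r](e_gen (arc_dist a c)) // (L _ _ (P_hom (e_ h'))).
rewrite (L _ _ (P_hom (e_ h))) (P_hom_e h' (arc_dist a c)).
rewrite (P_hom_e h (arcD h' (arc_dist a c))) scalerA mulrC -scalerA.
congr (_ *: _); rewrite /e_.
have -> : alpha + (beta + dist a c) = dist a c + tau Re * 1%:R.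
  by rewrite -ab; ring.
by rewrite (turnsD 1%N) ?dist_ge0 // addn1 exprS.
Qed.

Definition sumP (I : finType) (x : I -> S1) : rep := dsum (fun i => P (x i)).

Definition fin_gen (V : rep) :=
  exists (I : finType) (x : I -> S1) (f : hom (sumP x) V), epi f.

Lemma P_projective a : rep_projective (P a).
Proof.
move=> V W g h /(_ a (h a (e_ (arc0 a)))) [v gv].
by exists (P_hom v); apply: P_hom_inj; rewrite -gv /= -[in RHS](P_homE v).
Qed.

Lemma sumP_projective (I : finType) (x : I -> S1) : rep_projective (sumP x).
Proof.
move=> V W g h eg.
have k i : {k : hom (P (x i)) V | hom_comp g k = hom_comp h (dsum_in _ i)}.
  by apply/cid/P_projective.
exists (\sum_i hom_comp (sval (k i)) (dsum_out _ i)).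
apply: hom_ext => a v; rewrite /hom_comp /= hom_sumE linear_sum.
have {2}-> : v = \sum_i dsum_in (fun i => P (x i)) i a (v i).
  apply: functional_extensionality_dep => j; rewrite dprod_sumE (bigD1 j) //=.
  rewrite /dsum_in_fun dfwith_in big1 ?addr0 // => i ij.
  by rewrite dfwith_out.
rewrite linear_sum; apply: eq_bigr => i _.
have /(congr1 (fun f : hom (P (x i)) W => f a (v i))) := svalP (k i).
by [].
Qed.

Lemma sumP_fin_gen (I : finType) (x : I -> S1) : fin_gen (sumP x).
Proof. by exists I, x, (hom_id _) => a w; exists w. Qed.

Definition depthP a b (f : hom (P a) (P b)) : \bar Re :=
  if `[< f = 0 >] then +oo%E
  else (xget 0 [set alpha | exists (h : arc b a alpha) (u : R),
                  u \is a GRing.unit /\ f a (e_ (arc0 a)) = u *: e_ h])%:E.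

Definition depth_sumP (I J : finType) (x : I -> S1) (y : J -> S1)
    (f : hom (sumP x) (sumP y)) : \bar Re :=
  \big[Order.min/+oo%E]_j \big[Order.min/+oo%E]_i
    depthP (hom_comp (dsum_out _ j) (hom_comp f (dsum_in _ i))).

(* The depth of f : V -> W is computed in decompositions of V and W as direct
   sums of P_[x]'s, of which it is independent.  The default value +oo is only
   used when there is no decomposition. *)
Definition depth (V W : rep) (f : hom V W) : \bar Re :=
  xget +oo%E [set delta | exists (I J : finType) (x : I -> S1) (y : J -> S1)
    (phi : hom (sumP x) V) (psi : hom W (sumP y)),
    [/\ @is_iso Rep_cat _ _ phi, @is_iso Rep_cat _ _ psi &
        delta = depth_sumP (hom_comp psi (hom_comp f phi))]].

Record F_obj := FObj {
  F_rep :> rep;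
  F_fin_gen : fin_gen F_rep;
  F_projective : rep_projective F_rep;
  F_d : hom F_rep F_rep;
  F_sq : forall a v, F_d a (F_d a v) = t *: v
}.

Record F_hom (X Y : F_obj) := FHom {
  F_hom_val :> hom X Y;
  F_hom_d : hom_comp F_hom_val (F_d X) = hom_comp (F_d Y) F_hom_val
}.

Lemma F_hom_ext X Y (f g : F_hom X Y) : f = g :> hom X Y -> f = g.
Proof.
case: f g => [f cf] [g cg] /= fg; case: _ / fg cg => cg.
by rewrite (Prop_irrelevance cf cg).
Qed.

HB.instance Definition _ X Y := gen_eqMixin (F_hom X Y).
HB.instance Definition _ X Y := gen_choiceMixin (F_hom X Y).

Section FHomGroup.
Variables X Y : F_obj.
Implicit Types f g : F_hom X Y.

Program Definition F_zero : F_hom X Y := @FHom X Y 0 _.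
Next Obligation. by apply: hom_ext => a v /=; rewrite linear0. Qed.

Program Definition F_opp f : F_hom X Y := @FHom X Y (- (f : hom X Y)) _.
Next Obligation.
move=> f; apply: hom_ext => a v /=; rewrite linearN.
by have /(congr1 (fun h : hom X Y => h a v)) /= -> := F_hom_d f.
Qed.

Program Definition F_add f g : F_hom X Y :=
  @FHom X Y ((f : hom X Y) + (g : hom X Y)) _.
Next Obligation.
move=> f g; apply: hom_ext => a v /=; rewrite linearD.
have /(congr1 (fun h : hom X Y => h a v)) /= -> := F_hom_d f.
by have /(congr1 (fun h : hom X Y => h a v)) /= -> := F_hom_d g.
Qed.

Let addA : associative F_add.
Proof. by move=> f g h; apply: F_hom_ext; apply: addrA. Qed.
Let addC : commutative F_add.
Proof. by move=> f g; apply: F_hom_ext; apply: addrC. Qed.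
Let add0 : left_id F_zero F_add.
Proof. by move=> f; apply: F_hom_ext; apply: add0r. Qed.
Let addN : left_inverse F_zero F_opp F_add.
Proof. by move=> f; apply: F_hom_ext; apply: addNr. Qed.

HB.instance Definition _ := GRing.isZmodule.Build (F_hom X Y) addA addC add0 addN.

End FHomGroup.

Program Definition F_id X : F_hom X X := @FHom X X (hom_id X) _.
Next Obligation. by move=> X; apply: hom_ext. Qed.

Program Definition F_comp X Y Z (g : F_hom Y Z) (f : F_hom X Y) : F_hom X Z :=
  @FHom X Z (hom_comp g f) _.
Next Obligation.
move=> X Y Z g f; apply: hom_ext => a v /=.
have /(congr1 (fun h : hom X Y => h a v)) /= -> := F_hom_d f.
by have /(congr1 (fun h : hom Y Z => h a (f a v))) /= -> := F_hom_d g.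
Qed.

Program Definition F_pi : preadditive :=
  @Preadditive F_obj (fun X Y => F_hom X Y) F_id F_comp _ _ _ _ _.
Next Obligation. by move=> *; apply/F_hom_ext/hom_ext. Qed.
Next Obligation. by move=> *; apply/F_hom_ext/hom_ext. Qed.
Next Obligation. by move=> *; apply/F_hom_ext/hom_ext. Qed.
Next Obligation. by move=> *; apply/F_hom_ext/hom_ext. Qed.
Next Obligation.
by move=> *; apply/F_hom_ext/hom_ext => a v /=; rewrite linearD.
Qed.

Definition F_pi_exact : seq_class F_pi :=
  fun X Y Z (f : F_hom X Y) (g : F_hom Y Z) => short_exact f g.

Definition in_F_c (theta : Re) (X : F_pi) := (theta%:E <= depth (F_d X))%E.

Definition F_c (theta : Re) : preadditive := full_subcategory (in_F_c theta).

Definition F_c_exact (theta : Re) : seq_class (F_c theta) :=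
  fun X Y Z f g => @F_pi_exact (sval X) (sval Y) (sval Z) f g.

Section E.
Variables (x y : Re) (xy : x <= y <= x + tau Re).

Lemma E_alpha : arc (cls y) (cls x) (y - x).
Proof.
case/andP: xy => h _; rewrite -[in cls x](subKr y x).
by apply: arc_cls; rewrite subr_ge0.
Qed.

Lemma E_beta : arc (cls x) (cls y) (x + tau Re - y).
Proof.
case/andP: xy => _ h; have -> : cls y = cls (x - (x + tau Re - y)).
  apply/cls_eq; rewrite /circle_rel.
  have -> : y - (x - (x + tau Re - y)) = tau Re by ring.
  by rewrite mulfV ?rpred1 // gt_eqF ?tau_gt0.
by apply: arc_cls; rewrite subr_ge0.
Qed.

Definition E_pt (i : bool) : S1 := if i then cls y else cls x.

Definition alpha_star : hom (P (cls x)) (P (cls y)) := P_hom (e_ E_alpha).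
Definition beta_star : hom (P (cls y)) (P (cls x)) := P_hom (e_ E_beta).

Definition E_entry (j i : bool) : hom (P (E_pt i)) (P (E_pt j)) :=
  match j, i with
  | false, true => beta_star
  | true, false => alpha_star
  | false, false => 0
  | true, true => 0
  end.

Definition E_d : hom (sumP E_pt) (sumP E_pt) := mxhom E_entry.

Lemma E_sq a v : E_d a (E_d a v) = t *: v.
Proof.
apply: functional_extensionality_dep => j.
rewrite mxhomE big_bool !mxhomE !big_bool.
case: j; rewrite /E_entry /=.
  rewrite !(add0r, addr0) P_hom_t //; ring.
rewrite !(add0r, addr0) P_hom_t //; ring.
Qed.

Definition E : F_pi := FObj (sumP_fin_gen E_pt) (sumP_projective (x := E_pt)) E_sq.

End E.

End Representations.

Arguments E {Re R} t x y xy.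

Lemma E_range (Re : realType) (c theta : Re) :
  0 < c -> 0 < theta -> c + theta = pi ->
  forall x, x <= x + theta <= x + tau Re.
Proof. by rewrite /tau => c0 t0 <- x; apply/andP; split; lra. Qed.

Lemma E_range' (Re : realType) (c theta : Re) :
  0 < c -> 0 < theta -> c + theta = pi ->
  forall x, x + theta <= x + tau Re <= x + theta + tau Re.
Proof. by rewrite /tau => c0 t0 <- x; apply/andP; split; lra. Qed.

(* Main.v *)
From HB Require Import structures.
From mathcomp Require Import all_boot all_order all_algebra.
From mathcomp Require Import boolp classical_sets reals trigo ereal.
From mathcomp Require Import ring lra.
Require Import Defs.

(** An endomorphism d of a finitely generated projective representation has
    depth at least theta if and only if each of its values comes from the point of
    the circle that lies theta before it ([deep], [deep_depth]).  This makes sense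
    without coordinates once such a representation is known to be a finite sum of
    representations P ([fg_projective_sumP]), which holds because the endomorphism
    ring R of P is local.

    The exact sequences of F_c are the sequences that split as sequences of
    representations ([exact_split]); conversely, a morphism of F_c with a section
    (a retraction) at the level of representations is a deflation (an inflation),
    because the projection 1 - s g (or 1 - f r) inherits enough compatibility with
    d for its image to carry a differential ([idempotent_object]).  Quillen's
    axioms follow by linear algebra ([F_c_exact_category]).

    Let E = E(x, x + theta), with generators e at [x] and e' at [x + theta].  The
    differential sends e to the translate of e' by theta.  If X lies in F_c and v
    is an element of X at [x], then d v comes from a unique element w at
    [x + theta], and sending e to v and e' to w defines a morphism from E to X
    ([hom_from_Ec]).  Therefore E represents evaluation at [x] and is projective.
    Dually, morphisms from X to E correspond to morphisms of representations from
    X to P_[x + theta] ([hom_to_Ec]), and E is injective.  Applied to the summands P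
    of the representation underlying X, the two properties present X as a quotient
    and as a subobject of finite sums of objects E ([Ec_cover], [Ec_hull]).  Hence
    there are enough projectives and injectives, both being the retracts of finite
    sums of objects E, so that they coincide ([F_c_frobenius]).

    Finally, the endomorphism ring of E is R[d] / (d^2 - t).  It has no idempotents
    other than 0 and 1 since t is not a unit, so E is indecomposable; and it
    is local, so an indecomposable retract of a sum of objects E is one of them
    ([local_decomposition], [projective_indecomposable]).  The isomorphism between
    E(x, x + theta) and E(x + theta, x + 2 pi) exchanges the two generators
    ([E_swap]). *)

Set Implicit Arguments.
Unset Strict Implicit.
Unset Printing Implicit Defensive.

Import Order.TTheory GRing.Theory Num.Theory.
Local Open Scope ring_scope.

(** * Retracts and direct sums in preadditive categories *)
Section Preadditive.
Local Open Scope cat_scope.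
Variable C : preadditive.
Implicit Types X Y Z : C.

Lemma cmp0m X Y Z (f : mor X Y) : (0 : mor Y Z) \c f = 0.
Proof. by apply: (addrI (0 \c f)); rewrite -cmpDl !addr0. Qed.

Lemma cmpm0 X Y Z (g : mor Y Z) : g \c (0 : mor X Y) = 0.
Proof. by apply: (addrI (g \c 0)); rewrite -cmpDr !addr0. Qed.

Lemma cmpNm X Y Z (g : mor Y Z) (f : mor X Y) : (- g) \c f = - (g \c f).
Proof. by apply: (addrI (g \c f)); rewrite -cmpDl !subrr cmp0m. Qed.

Lemma cmpmN X Y Z (g : mor Y Z) (f : mor X Y) : g \c (- f) = - (g \c f).
Proof. by apply: (addrI (g \c f)); rewrite -cmpDr !subrr cmpm0. Qed.

Lemma cmpBl X Y Z (g g' : mor Y Z) (f : mor X Y) :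
  (g - g') \c f = g \c f - g' \c f.
Proof. by rewrite cmpDl cmpNm. Qed.

Lemma cmpBr X Y Z (g : mor Y Z) (f f' : mor X Y) :
  g \c (f - f') = g \c f - g \c f'.
Proof. by rewrite cmpDr cmpmN. Qed.

Lemma cmp_suml X Y Z (I : Type) (s : seq I) (G : I -> mor Y Z) (f : mor X Y) :
  (\sum_(i <- s) G i) \c f = \sum_(i <- s) G i \c f.
Proof.
elim: s => [|i s IH]; first by rewrite !big_nil cmp0m.
by rewrite !big_cons cmpDl IH.
Qed.

Lemma cmp_sumr X Y Z (I : Type) (s : seq I) (g : mor Y Z) (F : I -> mor X Y) :
  g \c (\sum_(i <- s) F i) = \sum_(i <- s) g \c F i.
Proof.
elim: s => [|i s IH]; first by rewrite !big_nil cmpm0.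
by rewrite !big_cons cmpDr IH.
Qed.

Lemma isomorphic_sym X Y : isomorphic X Y -> isomorphic Y X.
Proof. by move=> [f [g [gf fg]]]; exists g, f. Qed.

Lemma zero_mor X Y (f : mor X Y) : is_zero Y -> f = 0.
Proof. by move=> Y0; rewrite -[f]cmp1m [idm Y]Y0 cmp0m. Qed.

Lemma isomorphic_zero X Y : isomorphic X Y -> is_zero Y -> is_zero X.
Proof. by move=> [f [g [gf _]]] Y0; rewrite /is_zero -gf (zero_mor f Y0) cmpm0. Qed.

Lemma isomorphic_indecomposable X Y :
  isomorphic X Y -> indecomposable Y -> indecomposable X.
Proof.
move=> XY [Y0 Yind]; split.
  by move=> X0; apply: Y0; apply: isomorphic_zero X0; apply: isomorphic_sym.
case: XY => f [g [gf fg]] A B [i1 [i2 [p1 [p2 [p1i1 p2i2 p1i2 p2i1 sum1]]]]].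
apply: Yind; exists (f \c i1), (f \c i2), (p1 \c g), (p2 \c g).
have E Z W (p : mor X Z) (i : mor W X) : p \c g \c (f \c i) = p \c i.
  by rewrite cmpA -(cmpA p) gf cmpm1.
rewrite /is_biproduct !E; split => //.
transitivity (f \c (i1 \c p1 + i2 \c p2) \c g).
  by rewrite cmpDr cmpDl !cmpA.
by rewrite sum1 cmpm1.
Qed.

Definition retract X Y := exists (i : mor X Y) (p : mor Y X), p \c i = idm X.

Lemma isomorphic_retract X Y : isomorphic X Y -> retract X Y.
Proof. by move=> [f [g [gf _]]]; exists f, g. Qed.

(** Given a biproduct of X and Y, a pushout is a cokernel and a pullback (below)
    is a kernel; so only kernels and cokernels have to be constructed in F_c. *)
Lemma pushout_of_cokernel X Y Z B P (f : mor Z X) (g : mor Z Y)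
    (i1 : mor X B) (i2 : mor Y B) (p1 : mor B X) (p2 : mor B Y) (q : mor B P) :
  is_biproduct i1 i2 p1 p2 -> is_cokernel (i1 \c f - i2 \c g) q ->
  is_pushout (q \c i1) (q \c i2) f g.
Proof.
move=> [p1i1 p2i2 p1i2 p2i1 sum1] [qu univ]; split.
  by apply/eqP; rewrite -subr_eq0 -!cmpA -cmpBr qu.
move=> W u v uv; set h := u \c p1 + v \c p2.
have hi1 : h \c i1 = u by rewrite cmpDl -!cmpA p1i1 p2i1 cmpm1 cmpm0 addr0.
have hi2 : h \c i2 = v by rewrite cmpDl -!cmpA p2i2 p1i2 cmpm1 cmpm0 add0r.
have [|k [kq kuniq]] := univ W h.
  by rewrite cmpBr !cmpA hi1 hi2 uv subrr.
exists k; split; first by rewrite !cmpA kq.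
move=> k' [k'1 k'2]; apply: kuniq.
by rewrite -[LHS]cmpm1 -sum1 cmpDr !cmpA -[k' \c q \c i1]cmpA k'1
  -[k' \c q \c i2]cmpA k'2.
Qed.

Lemma pullback_of_kernel X Y Z B P (f : mor X Z) (g : mor Y Z)
    (i1 : mor X B) (i2 : mor Y B) (p1 : mor B X) (p2 : mor B Y) (k : mor P B) :
  is_biproduct i1 i2 p1 p2 -> is_kernel k (f \c p1 - g \c p2) ->
  is_pullback (p1 \c k) (p2 \c k) f g.
Proof.
move=> [p1i1 p2i2 p1i2 p2i1 sum1] [uk univ]; split.
  by apply/eqP; rewrite -subr_eq0 !cmpA -cmpBl uk.
move=> W u v uv; set h := i1 \c u + i2 \c v.
have hp1 : p1 \c h = u by rewrite cmpDr !cmpA p1i1 p1i2 cmp1m cmp0m addr0.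
have hp2 : p2 \c h = v by rewrite cmpDr !cmpA p2i2 p2i1 cmp1m cmp0m add0r.
have [|l [kl luniq]] := univ W h.
  by rewrite cmpBl -!cmpA hp1 hp2 uv subrr.
exists l; split; first by rewrite -!cmpA kl.
move=> l' [l'1 l'2]; apply: luniq.
by rewrite -[LHS]cmp1m -sum1 cmpDl -!cmpA [p1 \c _]cmpA l'1 [p2 \c _]cmpA l'2.
Qed.

Section RetractObjects.
Variable ex : seq_class C.

Lemma retract_projective X Y :
  retract X Y -> projective_object ex Y -> projective_object ex X.
Proof.
move=> [i [p pi]] Yproj Z W g h /(Yproj _ _ _ (h \c p)) [k gk].
by exists (k \c i); rewrite cmpA gk -cmpA pi cmpm1.
Qed.

Lemma retract_injective X Y :
  retract X Y -> injective_object ex Y -> injective_object ex X.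
Proof.
move=> [i [p pi]] Yinj Z W f h /(Yinj _ _ _ (i \c h)) [k kf].
by exists (p \c k); rewrite -cmpA kf cmpA pi cmp1m.
Qed.

End RetractObjects.

Definition is_direct_sum (J : finType) (E : J -> C) X
    (a : forall j, mor (E j) X) (b : forall j, mor X (E j)) :=
  [/\ forall j, b j \c a j = idm (E j),
      forall j k, j != k -> b j \c a k = 0 &
      \sum_j a j \c b j = idm X].

(** Locality of the endomorphism ring of X, in terms of its units. *)
Definition local_object X := forall f : mor X X, is_iso f \/ is_iso (idm X - f).

Definition idempotents_split := forall X (e : mor X X), e \c e = e ->
  exists Y (i : mor Y X) (p : mor X Y), p \c i = idm Y /\ i \c p = e.

Lemma complement_of_retract X Y (q : mor Y X) (p : mor X Y) :
  idempotents_split -> p \c q = idm Y ->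
  exists Z (i : mor Z X) (r : mor X Z), is_biproduct q i p r.
Proof.
move=> split pq.
have ee : (idm X - q \c p) \c (idm X - q \c p) = idm X - q \c p.
  rewrite cmpBl !cmpBr !cmp1m cmpm1.
  by rewrite cmpA -(cmpA q) pq cmpm1 subrr subr0.
have [Z [i [r [ri ir]]]] := split _ _ ee; exists Z, i, r; split=> //.
- have -> : p \c i = p \c (i \c r) \c i by rewrite -!cmpA ri cmpm1.
  by rewrite ir cmpBr cmpm1 cmpA pq cmp1m subrr cmp0m.
- have -> : r \c q = r \c (i \c r \c q) by rewrite !cmpA ri cmp1m.
  by rewrite ir cmpBl cmp1m -cmpA pq cmpm1 subrr cmpm0.
by rewrite ir addrC subrK.
Qed.

(** The existence half of the Krull-Schmidt theorem: a retract of a finite sum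
    of objects with local endomorphism rings is again such a sum.  The retract is
    given by [g] and [h].  If [h i \c g i] is invertible, then [E i] splits
    off X, and the complement is a retract of the sum of the other terms, since
    its projection kills [g i].  Otherwise [1 - h i \c g i] is invertible, and so
    is [1 - g i \c h i], which is the sum of the other terms: X is already a
    retract of their sum. *)
Theorem local_decomposition (I : Type) (E : I -> C) :
  idempotents_split -> (forall i, local_object (E i)) ->
  forall (s : seq I) X (g : forall i, mor (E i) X) (h : forall i, mor X (E i)),
  \sum_(i <- s) g i \c h i = idm X ->
  exists (J : finType) (k : J -> I) (a : forall j, mor (E (k j)) X)
    (b : forall j, mor X (E (k j))), is_direct_sum a b.
Proof.
move=> split loc; elim=> [|i s IH] X g h.
  rewrite big_nil => X0.
  exists void, (of_void I), (fun j : void => match j with end),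
    (fun j : void => match j with end).
  by split; [case|case|rewrite -X0 big1 // => -[]].
rewrite big_cons; set K := \sum_(j <- s) _ => gK.
have {gK} KE : K = idm X - g i \c h i by rewrite -gK addrC addKr.
have [[l [lhg hgl]]|[m [m1 m2]]] := loc i (h i \c g i).
  have pq : (l \c h i) \c g i = idm (E i) by rewrite -cmpA.
  have [Z [z [r [_ rz pz rq sum1]]]] := complement_of_retract split pq.
  have [|J [k [a [b [ba ba0 ab]]]]] :=
    IH Z (fun j => r \c g j) (fun j => h j \c z).
    transitivity (r \c K \c z).
      rewrite cmp_sumr cmp_suml; apply: eq_bigr => j _; by rewrite !cmpA.
    by rewrite KE cmpBr cmpm1 cmpA rq cmp0m subr0.
  pose k' (j : option J) := if j is Some j then k j else i.
  exists (option J), k'.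
  exists (fun j => match j return mor (E (k' j)) X with
                   | Some j => z \c a j | None => g i end).
  exists (fun j => match j return mor X (E (k' j)) with
                   | Some j => b j \c r | None => l \c h i end).
  split.
  - by case=> [j|//]; rewrite -cmpA (cmpA r) rz cmp1m ba.
  - case=> [j|] [j'|] // jj'.
    + by rewrite -cmpA (cmpA r) rz cmp1m ba0.
    + by rewrite -cmpA rq cmpm0.
    + by rewrite cmpA pz cmp0m.
  rewrite (bigD1 None) //= (reindex_omap Some id) => [|[]//] /=.
  transitivity (g i \c (l \c h i) + z \c (\sum_j a j \c b j) \c r).
    congr (_ + _); rewrite cmp_sumr cmp_suml.
    by apply: eq_big => [j|j _]; rewrite ?eqxx // !cmpA.
  by rewrite ab cmpm1.
(* L is the inverse of K = 1 - g h: from m = (1 - h g)^-1 one gets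
   (1 - g h)^-1 = 1 + g m h. *)
pose L := idm X + g i \c m \c h i.
apply: (IH X g (fun j => h j \c L)).
transitivity (K \c L).
  by rewrite cmp_suml; apply: eq_bigr => j _; rewrite cmpA.
have {}m2 : m - h i \c g i \c m = idm (E i) by rewrite -[m in m - _]cmp1m -cmpBl.
rewrite KE cmpBl cmp1m /L cmpDr cmpm1.
have -> : g i \c h i \c (g i \c m \c h i) = g i \c (h i \c g i \c m) \c h i.
  by rewrite !cmpA.
have -> : h i \c g i \c m = m - idm (E i) by rewrite -m2 subKr.
by rewrite cmpBr cmpBl cmpm1 [X in _ - X]addrC subrK addrK.
Qed.

End Preadditive.

(** * Morphisms of representations and splitting of idempotents *)
Section Representations.
Variables (Re : realType) (R : idomainType) (t : R).
Local Notation rep := (rep Re t).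
Local Notation P := (P (Re := Re) t).
Implicit Types (V W X : rep).

Section MakeHom.
Variables (V W : rep) (f : forall a, V a -> W a).
Hypothesis f_linear : forall a, linear (@f a).
Hypothesis f_nat : forall a b alpha (h : arc a b alpha) v,
  rep_map W h (f v) = f (rep_map V h v).

Definition linear_fun (_ : forall a, linear (@f a)) a : V a -> W a := @f a.

HB.instance Definition _ a :=
  GRing.isLinear.Build R (V a) (W a) _ (@linear_fun f_linear a) (@f_linear a).

Definition make_hom : hom V W :=
  @Hom Re R t V W (fun a => @linear_fun f_linear a) f_nat.

End MakeHom.

(** Lifts of elements along a monomorphism are unique; therefore, however they are
    chosen, they depend linearly and naturally on the element. *)
Lemma hom_lift V W X (j : hom W X) (f : hom V X) :
  mono j -> (forall a v, exists w, j a w = f a v) ->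
  exists k : hom V W, forall a v, j a (k a v) = f a v.
Proof.
move=> jmono jf; pose k a v := sval (cid (jf a v)).
have kE a v : j a (k a v) = f a v by rewrite /k; case: cid.
have klin a : linear (k a).
  by move=> c u v; apply: jmono; rewrite linearP !kE linearP.
have knat a b alpha (h : arc a b alpha) v :
    rep_map W h (k a v) = k b (rep_map V h v).
  by apply: jmono; rewrite -hom_nat !kE hom_nat.
by exists (make_hom klin knat).
Qed.

(** The image of an idempotent e, realized as the subrepresentation of the
    elements that e fixes. *)
Section FixedSubrep.
Variables (V : rep) (e : hom V V).

Definition fixed a : {pred V a} := fun v => e a v == v.

Lemma fixed_submod a : submod_closed (@fixed a).
Proof.
split=> [|c u v]; rewrite !unfold_in ?linear0 //.
by move=> /eqP uE /eqP vE; rewrite linearP uE vE.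
Qed.

HB.instance Definition _ a :=
  GRing.isSubmodClosed.Build R (V a) (@fixed a) (@fixed_submod a).

Record fixed_mod a := FixedMod {fixed_val :> V a; _ : fixed_val \in @fixed a}.

HB.instance Definition _ a := [isSub for @fixed_val a].
HB.instance Definition _ a := [Choice of fixed_mod a by <:].
HB.instance Definition _ a := [SubChoice_isSubLmodule of fixed_mod a by <:].

Lemma fixed_valE a (v : fixed_mod a) : e a (\val v) = \val v.
Proof. exact/eqP/(valP v). Qed.

Definition to_fixed a b (f : {linear V a -> V b})
    (ef : forall v : fixed_mod a, e b (f (\val v)) = f (\val v)) v : fixed_mod b :=
  FixedMod (introT eqP (ef v)).

Lemma to_fixed_linear a b f ef : linear (@to_fixed a b f ef).
Proof. by move=> c u v; apply: val_inj; rewrite /= linearP. Qed.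

HB.instance Definition _ a b f ef :=
  GRing.isLinear.Build R (fixed_mod a) (fixed_mod b) _ _ (@to_fixed_linear a b f ef).

Program Definition fixed_rep : rep :=
  @Rep Re R t (fun a => fixed_mod a)
    (fun a b alpha h => @to_fixed a b (rep_map V h) _) _ _.
Next Obligation. by move=> a b alpha h v; rewrite -hom_nat fixed_valE. Qed.
Next Obligation. by move=> *; apply: val_inj; apply: rep_comp. Qed.
Next Obligation. by move=> *; apply: val_inj; apply: rep_turn. Qed.

Hypothesis ee : forall a v, e a (e a v) = e a v.

Definition fixed_in : hom fixed_rep V :=
  @make_hom fixed_rep V (fun a v => \val v) (fun a c u v => erefl)
    (fun a b alpha h v => erefl).

Program Definition fixed_out : hom V fixed_rep :=
  @make_hom V fixed_rep (fun a v => FixedMod (introT eqP (ee v))) _ _.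
Next Obligation. by move=> a c u v; apply: val_inj; rewrite /= linearP. Qed.
Next Obligation. by move=> a b alpha h v; apply: val_inj; apply: hom_nat. Qed.

End FixedSubrep.

Lemma rep_idempotents_split V (e : hom V V) :
  (forall a v, e a (e a v) = e a v) ->
  exists W (i : hom W V) (p : hom V W),
    (forall a w, p a (i a w) = w) /\ (forall a v, i a (p a v) = e a v).
Proof.
move=> ee; exists (fixed_rep e), (fixed_in e), (fixed_out ee); split=> // a w.
by apply: val_inj; apply: fixed_valE.
Qed.

End Representations.

(** * Finitely generated projective representations *)
Section FinGenProjective.
Variables (Re : realType) (R : idomainType) (t : R).
Local Notation rep := (rep Re t).
Local Notation P := (P (Re := Re) t).
Implicit Types (V W X : rep).

Lemma hom_eq V W (f g : hom V W) : f = g -> forall a v, f a v = g a v.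
Proof. by move=> ->. Qed.

Definition fg_projective V := fin_gen V /\ rep_projective V.

Lemma epi_section V W (g : hom V W) :
  rep_projective W -> epi g -> exists s : hom W V, forall a w, g a (s a w) = w.
Proof.
move=> Wproj /(Wproj _ _ _ (hom_id W)) [s gs]; exists s => a w.
exact: (hom_eq gs).
Qed.

Lemma retract_fg_projective V W (i : hom V W) (p : hom W V) :
  (forall a v, p a (i a v) = v) -> fg_projective W -> fg_projective V.
Proof.
move=> pi [[I [x [f fepi]]] Wproj]; split.
  exists I, x, (hom_comp p f) => a v; have [w fw] := fepi a (i a v).
  by exists w; rewrite /= fw pi.
move=> X Y g h /(Wproj _ _ _ (hom_comp h p)) [k gk]; exists (hom_comp k i).
apply: hom_ext => a v.
by have := hom_eq gk (i a v); rewrite /= pi.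
Qed.

Lemma fg_projective_retract V : fg_projective V ->
  exists (I : finType) (x : I -> circle Re) (i : hom V (sumP t x))
    (p : hom (sumP t x) V), forall a v, p a (i a v) = v.
Proof.
move=> [[I [x [p pepi]]] Vproj]; have [i pi] := epi_section Vproj pepi.
by exists I, x, i, p.
Qed.

Lemma dsum_ext (I : finType) (V : I -> rep) a (v w : dsum V a) :
  (forall i, v i = w i) -> v = w.
Proof. exact: functional_extensionality_dep. Qed.

Lemma dsum_sum_in (I : finType) (V : I -> rep) a (v : dsum V a) :
  v = \sum_i dsum_in V i a (v i).
Proof.
apply: dsum_ext => j; rewrite dprod_sumE (bigD1 j) //= /dsum_in_fun.
by rewrite dfwith_in big1 ?addr0 // => i ij; rewrite dfwith_out.
Qed.

Lemma dsum_inE (I : finType) (V : I -> rep) i a (v : V i a) :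
  dsum_in V i a v i = v.
Proof. exact: dfwith_in. Qed.

Lemma dsum_in_ne (I : finType) (V : I -> rep) i j a (v : V i a) :
  i != j -> dsum_in V i a v j = 0.
Proof. exact: dfwith_out. Qed.

Lemma dsum_out_hom (I : finType) (V : I -> rep) W (f : forall i, hom W (V i)) :
  exists h : hom W (dsum V), forall a w i, h a w i = f i a w.
Proof.
unshelve eexists (@make_hom _ _ _ W (dsum V) (fun a w i => f i a w) _ _) => //.
  by move=> a c u v; apply: dsum_ext => i; apply: linearP.
by move=> a b alpha h v; apply: dsum_ext => i; apply: hom_nat.
Qed.

Lemma dsum_in_hom (I : finType) (V : I -> rep) W (f : forall i, hom (V i) W) :
  exists h : hom (dsum V) W, forall a v, h a v = \sum_i f i a (v i).
Proof.
exists (\sum_i hom_comp (f i) (dsum_out V i)) => a v.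
by rewrite hom_sumE.
Qed.

Lemma dsum_fg_projective (I : finType) (V : I -> rep) :
  (forall i, fg_projective (V i)) -> fg_projective (dsum V).
Proof.
move=> Vfg; split; last first.
  move=> X Y g h gepi.
  have k i : {k : hom (V i) X | hom_comp g k = hom_comp h (dsum_in V i)}.
    by apply/cid/(proj2 (Vfg i)).
  have [k' k'E] := dsum_in_hom (fun i => sval (k i)).
  exists k'; apply: hom_ext => a v /=; rewrite k'E linear_sum.
  rewrite [v in RHS]dsum_sum_in linear_sum; apply: eq_bigr => i _.
  exact: (hom_eq (svalP (k i))).
pose J i := projT1 (cid (proj1 (Vfg i))).
have xf i : {x : J i -> circle Re &
    {f : hom (sumP t x) (V i) | epi f}}.
  rewrite /J; case: cid => K /= /cid [x /cid [f fepi]]; by exists x, f.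
pose x i := projT1 (xf i); pose f i := sval (projT2 (xf i)).
have fepi i : epi (f i) := svalP (projT2 (xf i)).
pose y (u : {i : I & J i}) := x (tag u) (tagged u).
exists {i : I & J i}, y.
pose cut a (v : sumP t y a) i : sumP t (x i) a := fun j => v (Tagged J j).
unshelve eexists.
  apply: (@make_hom _ _ _ (sumP t y) (dsum V) (fun a v i => f i a (cut a v i))).
  - move=> a c u v; apply: dsum_ext => i.
    transitivity (f i a (c *: cut a u i + cut a v i)); last exact: linearP.
    by congr (f i a _); apply: dsum_ext.
  - move=> a b alpha h v; apply: dsum_ext => i /=; rewrite /dsum_map hom_nat.
    by congr (f i b _); apply: dsum_ext.
move=> a w; have fv i : {v | f i a v = w i} by exact/cid/fepi.
pose v i := sval (fv i).
exists (fun u => v (tag u) (tagged u)); apply: dsum_ext => i /=.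
rewrite -[RHS](svalP (fv i)); congr (f i a _); apply: dsum_ext.
Qed.

Hypothesis t_neq0 : t != 0.

(** The representations [P a] have injective structure maps because t is
    a nonzerodivisor; retracts of their sums inherit this. *)
Lemma fg_projective_map_inj V a b alpha (h : arc a b alpha) :
  fg_projective V -> injective (rep_map V h).
Proof.
move=> /fg_projective_retract [I [x [i [p pi]]]] v w vw.
rewrite -[v]pi -[w]pi; congr (p a _).
have {vw} /= iE : rep_map (sumP t x) h (i a v) = rep_map (sumP t x) h (i a w).
  by rewrite !hom_nat vw.
apply: (@dsum_ext I (fun j => P (x j)) a) => j.
have /(congr1 (fun u : sumP t x b => u j)) := iE.
exact: (mulfI (expf_neq0 _ t_neq0)).
Qed.

Definition scale_hom V (r : R) : hom V V.
Proof.
apply: (@make_hom _ _ _ V V (fun a v => r *: v)).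
- by move=> a c u v; rewrite scalerDr !scalerA mulrC.
- by move=> a b alpha h v; rewrite linearZ.
Defined.

(** A generator of [P a] is mapped to an element of [P a] at the same point of
    the circle, that is, to a multiple of itself. *)
Lemma P_end a (f : hom (P a) (P a)) : exists r, f = scale_hom (P a) r.
Proof.
exists (f a (e_ t (arc0 a)) : R); apply: P_hom_inj.
rewrite /scale_hom /= /linear_fun /e_ turns0 ?lexx ?tau_gt0 //.
by rewrite expr0 [RHS]mulr1.
Qed.

Hypothesis R_local : forall r : R, (r \is a GRing.unit) || (1 - r \is a GRing.unit).

Lemma scale_hom_iso V (r : R) :
  r \is a GRing.unit -> @is_iso (Rep_cat Re t) V V (scale_hom V r).
Proof.
move=> ru; exists (scale_hom V r^-1).
split; apply: hom_ext => a v /=;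
  by rewrite /linear_fun scalerA ?mulVr ?mulrV ?scale1r.
Qed.

Lemma P_local a : @local_object (Rep_cat Re t) (P a).
Proof.
move=> f; have [r ->] := P_end f.
have [ru|ru] := orP (R_local r); [left|right]; first exact: scale_hom_iso.
have -> : idm (P a : Rep_cat Re t) - scale_hom (P a) r = scale_hom (P a) (1 - r).
  apply: hom_ext => b v; rewrite /= /linear_fun scalerBl scale1r.
  by [].
exact: scale_hom_iso.
Qed.

(** Since the endomorphism ring R of [P a] is local, the decomposition theorem
    applies. *)
Theorem fg_projective_sumP V : fg_projective V ->
  exists (J : finType) (x : J -> circle Re)
    (phi : hom (sumP t x) V) (psi : hom V (sumP t x)),
  (forall a v, psi a (phi a v) = v) /\ (forall a v, phi a (psi a v) = v).
Proof.
move=> /fg_projective_retract [I [x [i [p pi]]]].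
have split : idempotents_split (Rep_cat Re t).
  move=> W e ee; have [|X [j [q [qj jq]]]] := @rep_idempotents_split _ _ _ W e.
    exact: (hom_eq ee).
  by exists X, j, q; split; apply: hom_ext.
have [||J [k [a [b [ba ba0 ab]]]]] := @local_decomposition (Rep_cat Re t) I
  (fun j => P (x j)) split _ (index_enum I) V
  (fun j => hom_comp p (dsum_in _ j)) (fun j => hom_comp (dsum_out _ j) i).
- by move=> j; apply: P_local.
- apply: hom_ext => c v; rewrite hom_sumE /= -[RHS]pi.
  by rewrite [in RHS](dsum_sum_in (i c v)) linear_sum.
exists J, (x \o k).
have [phi phiE] := dsum_in_hom (a : forall j, hom (P (x (k j))) V).
have [psi psiE] := dsum_out_hom (b : forall j, hom V (P (x (k j)))).
exists phi, psi; split=> c v.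
  apply: dsum_ext => j; rewrite psiE phiE linear_sum (bigD1 j) //=.
  rewrite big1 => [|l]; last first.
    rewrite eq_sym => jl; exact: (hom_eq (ba0 j l jl)).
  by rewrite addr0; exact: (hom_eq (ba j)).
rewrite phiE; under eq_bigr do rewrite psiE.
by have := hom_eq ab v; rewrite hom_sumE.
Qed.

End FinGenProjective.

(** * Factorization in a discrete valuation ring *)
Section Uniformizing.
Variables (R : idomainType) (t : R).

(** What the argument needs from the valuation, expressed inside R. *)
Definition uniformizing :=
  [/\ t != 0, t \isn't a GRing.unit &
      forall r : R, r != 0 -> exists n u, u \is a GRing.unit /\ r = u * t ^+ n].

Lemma dvr_uniformizing (nu : {fraction R} -> int) :
  is_dvr nu -> Defs.uniformizer nu t -> uniformizing.
Proof.
move=> dvr [t0 nut].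
have ft0 : tofrac t != 0 by rewrite tofrac_eq0.
have nu1 : nu 1 = 0.
  by apply: (addrI (nu 1)); rewrite -(dvrM dvr) ?oner_neq0 // mulr1 addr0.
have nuV x : x != 0 -> nu x^-1 = - nu x.
  move=> x0; apply: (addrI (nu x)).
  by rewrite subrr -(dvrM dvr) ?invr_eq0 // mulfV.
have nuX n : nu (tofrac t ^+ n) = n%:Z.
  elim: n => [|n IH]; first by rewrite expr0.
  by rewrite exprS (dvrM dvr) ?expf_neq0 // IH nut intS.
have unitP r : r != 0 -> nu (tofrac r) = 0 -> r \is a GRing.unit.
  move=> r0 nur; have fr0 : tofrac r != 0 by rewrite tofrac_eq0.
  have frV : (tofrac r)^-1 != 0 by rewrite invr_eq0.
  have [s sE] : exists s, (tofrac r)^-1 = tofrac s.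
    by apply/(dvr_ring dvr frV); rewrite nuV // nur oppr0.
  apply/unitrPr; exists s; apply/eqP; rewrite -tofrac_eq.
  by apply/eqP; rewrite tofracM tofrac1 -sE mulfV.
split=> //.
  apply/negP => /unitrPr [s ts].
  have s0 : s != 0.
    by apply: contra_eq_neq ts => ->; rewrite mulr0 eq_sym oner_neq0.
  have fs0 : tofrac s != 0 by rewrite tofrac_eq0.
  have : 0 <= nu (tofrac s) by apply/(dvr_ring dvr fs0); exists s.
  have : nu (tofrac t * tofrac s) = 0 by rewrite -tofracM ts tofrac1.
  rewrite (dvrM dvr) // nut => /eqP; rewrite addr_eq0 => /eqP s1.
  by rewrite -oppr_le0 -s1.
move=> r r0; have fr0 : tofrac r != 0 by rewrite tofrac_eq0.
have : 0 <= nu (tofrac r) by apply/(dvr_ring dvr fr0); exists r.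
case nuE: (nu (tofrac r)) => [n|//] _.
pose x := tofrac r / tofrac t ^+ n.
have x0 : x != 0 by rewrite mulf_neq0 ?invr_eq0 ?expf_neq0.
have nux : nu x = 0.
  by rewrite (dvrM dvr) ?invr_eq0 ?expf_neq0 // nuV ?expf_neq0 // nuX nuE subrr.
have [u uE] : exists u, x = tofrac u by apply/(dvr_ring dvr x0); rewrite nux.
have u0 : u != 0 by rewrite -tofrac_eq0 -uE.
exists n, u; split; first by apply: unitP; rewrite -?uE.
by apply/eqP; rewrite -tofrac_eq; apply/eqP;
  rewrite tofracM tofracXn -uE divfK ?expf_neq0.
Qed.

Hypothesis tP : uniformizing.

Lemma unit_exp_le (u w : R) n m :
  u \is a GRing.unit -> u * t ^+ n = w * t ^+ m -> (m <= n)%N.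
Proof.
case: tP => t0 tN _ uu E; rewrite leqNgt; apply/negP => nm; case/negP: tN.
have {}E : u = w * t ^+ (m - n).
  by apply: (mulIf (expf_neq0 n t0)); rewrite E -mulrA -exprD subnK // ltnW.
move: uu; rewrite E unitrM => /andP[_].
by rewrite unitrX_pos ?subn_gt0.
Qed.

Lemma uniformizing_local (r : R) :
  (r \is a GRing.unit) || (1 - r \is a GRing.unit).
Proof.
case: tP => t0 tN fac.
have dvd s : s \isn't a GRing.unit -> exists q, s = q * t.
  have [->|/fac [n [u [uu ->]]]] := eqVneq s 0; first by exists 0; rewrite mul0r.
  case: n => [|n]; first by rewrite mulr1 uu.
  by exists (u * t ^+ n); rewrite exprSr mulrA.
apply/norP => -[/dvd [p rE] /dvd [q qE]]; case/negP: tN; apply/unitrPr.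
(* t divides both r and 1 - r, hence 1. *)
exists (p + q); rewrite mulrC mulrDl -qE -rE; ring.
Qed.

End Uniformizing.

(** * Depth *)
Section Depth.
Variables (Re : realType) (R : idomainType) (t : R).
Hypothesis tP : uniformizing t.
Local Notation rep := (rep Re t).
Local Notation P := (P (Re := Re) t).
Implicit Types (V W X : rep) (a b c : circle Re) (alpha beta theta : Re).

Lemma arc_back b theta : 0 <= theta -> exists a, arc a b theta.
Proof.
move=> theta0; exists (cls (repr b + theta)).
by rewrite -{2}(cls_repr b) -{2}(addrK theta (repr b)) arc_cls.
Qed.

Lemma arc_cancel a b c alpha theta :
  arc a b alpha -> arc c b theta -> theta <= alpha -> arc a c (alpha - theta).
Proof.
move=> /andP[_ /eqP bE] /andP[_ /eqP]; rewrite bE /rot => /cls_eq ac le.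
rewrite /arc subr_ge0 le -(cls_repr c); apply/eqP/cls_eq.
rewrite circle_rel_sym; move: ac; rewrite /circle_rel.
by congr (_ / _ \is a _); rewrite !opprB; ring.
Qed.

Lemma turns_eq alpha n a b :
  alpha = dist a b + tau Re * n%:R -> turns alpha = n.
Proof. by move=> ->; rewrite turnsD ?dist_ge0 // turns0 // dist_ge0 dist_lt. Qed.

Lemma arc_turns_le a b alpha beta : arc a b alpha -> arc a b beta ->
  (turns alpha <= turns beta)%N = (alpha <= beta).
Proof.
move=> ha hb; rewrite [in RHS](arc_turns ha) [in RHS](arc_turns hb) lerD2l.
by rewrite ler_pM2l ?tau_gt0 // ler_nat.
Qed.

Lemma P_homEarc V a (v : V a) b alpha (h : arc a b alpha) :
  P_hom v b (e_ t h) = rep_map V h v.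
Proof. by rewrite [RHS]rep_map_turns. Qed.

(** The condition that f has depth at least theta, without coordinates: every
    value of f comes from the point that lies theta before it.  Unlike the depth,
    which is defined by a decomposition, it is visibly stable under composition on
    both sides. *)
Definition deep theta V W (f : hom V W) := forall a b (h : arc a b theta) v,
  exists w, rep_map W h w = f b v.

Lemma deep_compl theta V W X (g : hom W X) (f : hom V W) :
  deep theta f -> deep theta (hom_comp g f).
Proof.
by move=> fdeep a b h v; have [w wE] := fdeep a b h v; exists (g a w);
  rewrite hom_nat wE.
Qed.

Lemma deep_compr theta V W X (g : hom W X) (f : hom V W) :
  deep theta g -> deep theta (hom_comp g f).
Proof. by move=> gdeep a b h v; apply: gdeep. Qed.

Lemma deep_eq theta V W (f g : hom V W) :
  (forall a v, f a v = g a v) -> deep theta f -> deep theta g.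
Proof. by move=> /hom_ext ->. Qed.

Lemma deep0 theta V W : deep theta (0 : hom V W).
Proof. by move=> a b h v; exists 0; rewrite linear0. Qed.

Lemma deep_dsum theta (I J : finType) (V : I -> rep) (W : J -> rep)
    (f : hom (dsum V) (dsum W)) :
  deep theta f <-> forall j i,
    deep theta (hom_comp (dsum_out W j) (hom_comp f (dsum_in V i))).
Proof.
split=> [fdeep j i|fdeep a b h v].
  exact/deep_compl/deep_compr.
have w j i := cid (fdeep j i a b h (v i)).
exists (fun j => \sum_i sval (w j i)); apply: dsum_ext => j.
rewrite [v in RHS]dsum_sum_in linear_sum dprod_sumE /= /dsum_map linear_sum.
by apply: eq_bigr => i _; rewrite (svalP (w j i)).
Qed.

Lemma deep_P_hom theta a b alpha (h : arc b a alpha) :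
  theta <= alpha -> deep theta (P_hom (e_ t h)).
Proof.
move=> le c d hcd v.
have hbd := arcD h (arc_dist a d).
have le' : theta <= alpha + dist a d by rewrite ler_wpDr ?dist_ge0.
have hbc := arc_cancel hbd hcd le'.
exists ((v : R) *: e_ t hbc); rewrite linearZ [in LHS]e_map.
rewrite [v in RHS](e_gen (arc_dist a d)) ?dist_lt // linearZ.
by rewrite [in RHS]P_hom_e /e_ subrK.
Qed.

(** A nonzero f maps e_a to u t^n e_b^gamma = u e_b^delta, where u is a unit and
    delta = gamma + 2 pi n, gamma being the distance from b to a; so its depth is
    delta.  Divisibility of u t^n by a power of t is what compares delta with
    theta. *)
Lemma deep_depthP theta a b (f : hom (P a) (P b)) : 0 <= theta ->
  (theta%:E <= depthP f)%E <-> deep theta f.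
Proof.
move=> theta0; rewrite /depthP; case: asboolP => [->|f0].
  by rewrite leey; split=> // _; apply: deep0.
set r : R := f a (e_ t (arc0 a)).
have r0 : r != 0.
  by apply/eqP => r0; apply: f0; apply: P_hom_inj; rewrite -/r r0.
have [_ _ /(_ r r0) [n [u [uu rE]]]] := tP.
pose delta := dist b a + tau Re * n%:R.
have hd : arc b a delta.
  have tau_ge0 := ltW (tau_gt0 Re).
  rewrite /arc (addr_ge0 (dist_ge0 b a) (mulr_ge0 tau_ge0 (ler0n _ n))) /=.
  have /andP[_ /eqP {1}->] := arc_dist b a.
  apply/eqP/cls_eq; rewrite /circle_rel /delta.
  have -> : repr b - dist b a - (repr b - (dist b a + tau Re * n%:R)) =
    n%:R * tau Re by ring.
  by rewrite mulfK ?natr_int // gt_eqF ?tau_gt0.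
have tn : turns delta = n by apply: turns_eq; reflexivity.
have fE : f = hom_comp (scale_hom (P b) u) (P_hom (e_ t hd)).
  apply: P_hom_inj; rewrite -/r /= P_homE /linear_fun /e_ tn; exact: rE.
rewrite (@xget_unique _ _ _ delta).
- rewrite lee_fin; split=> [le|fdeep].
    by rewrite fE; apply/deep_compl/deep_P_hom.
  have [c hc] := arc_back a theta0.
  have [w wE] := fdeep c a hc (e_ t (arc0 a)).
  have hb := arcD (arc_dist b c) hc.
  have le : (turns (dist b c + theta) <= turns delta)%N.
    rewrite tn; apply: (unit_exp_le tP uu (w := (w : R))).
    by apply: etrans (esym rE) _; rewrite /r -wE [RHS]mulrC.
  by move: le; rewrite (arc_turns_le hb hd); apply: le_trans; rewrite lerDr dist_ge0.
- by exists hd, u; split=> //; rewrite /e_ tn; exact: rE.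
move=> alpha [ha [w [wu wE]]]; rewrite (arc_turns ha) /delta; congr (_ + _ * _%:R).
apply/eqP; rewrite eqn_leq.
have {}wE : u * t ^+ n = w * t ^+ turns alpha by apply: etrans (esym rE) wE.
by rewrite (unit_exp_le tP uu wE) (unit_exp_le tP wu (esym wE)).
Qed.

Lemma deep_depth theta V W (f : hom V W) : 0 <= theta ->
  fg_projective V -> fg_projective W ->
  (theta%:E <= depth f)%E <-> deep theta f.
Proof.
move=> theta0 Vfg Wfg; rewrite /depth.
have [t0 _ _] := tP; have R_local := uniformizing_local tP.
have [I [x [phi [phi' [phiK phi'K]]]]] := fg_projective_sumP R_local Vfg.
have [J [y [psi' [psi [psi'K psiK]]]]] := fg_projective_sumP R_local Wfg.
have iso X Y (g : hom X Y) (g' : hom Y X) : (forall a v, g' a (g a v) = v) ->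
    (forall a v, g a (g' a v) = v) -> @is_iso (Rep_cat Re t) _ _ g.
  by move=> gK g'K; exists g'; split; apply: hom_ext.
set S := (X in xget _ X); have : S (xget +oo%E S).
  apply: xgetPex; exists (depth_sumP (hom_comp psi (hom_comp f phi))).
  by exists I, J, x, y, phi, psi; split=> //; [apply: iso phi'K|apply: iso psi'K].
move: {phi phi' phiK phi'K psi psi' psiK psi'K x y I J}(xget _ _).
move=> delta [I [J [x [y [phi [psi [phi_iso psi_iso ->]]]]]]].
case: phi_iso => phi' [/hom_eq phiK /hom_eq phi'K].
case: psi_iso => psi' [/hom_eq psiK /hom_eq psi'K].
have -> : (theta%:E <= depth_sumP (hom_comp psi (hom_comp f phi)))%E <->
   deep theta (hom_comp psi (hom_comp f phi)).
  rewrite deep_dsum; split=> [/bigmin_geP [_ le] j i|dp].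
    by apply/deep_depthP => //; have /bigmin_geP [_] := le j isT; apply.
  apply/bigmin_geP; split=> [|j _]; first by rewrite leey.
  apply/bigmin_geP; split=> [|i _]; first by rewrite leey.
  exact/deep_depthP.
split=> [dp|dp]; last by apply: deep_compl; apply: deep_compr.
have := deep_compl psi' (deep_compr phi' dp); apply: deep_eq => a v.
by have /= -> := psiK a (f a (phi a (phi' a v))); have /= -> := phi'K a v.
Qed.

Lemma deep_d theta (X : F_obj Re t) : 0 <= theta ->
  (in_F_c theta (X : F_pi Re t) : bool) <-> deep theta (F_d X).
Proof.
by move=> theta0; apply: deep_depth => //; split;
  [apply: F_fin_gen|apply: F_projective|apply: F_fin_gen|apply: F_projective].
Qed.

End Depth.

(** * Objects and morphisms of F_c *)
Section FrobeniusObjects.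
Variables (Re : realType) (R : idomainType) (t : R) (theta : Re).
Hypothesis tP : uniformizing t.
Hypothesis theta_ge0 : 0 <= theta.
Local Open Scope cat_scope.
Local Notation rep := (rep Re t).
Local Notation C := (F_c t theta).
Local Notation ex := (@F_c_exact Re R t theta).

Definition base (X : C) : F_obj Re t := sval X.

Local Notation d X := (F_d (base X)).

(** Equations between morphisms of F_c are verified on elements. *)
Definition act (X Y : C) (f : mor X Y) : hom (base X) (base Y) := F_hom_val f.

Lemma act_inj (X Y : C) (f g : mor X Y) :
  (forall a v, act f a v = act g a v) -> f = g.
Proof. by move=> fg; apply: F_hom_ext; apply: hom_ext. Qed.

Lemma act_d (X Y : C) (f : mor X Y) a v : act f a (d X a v) = d Y a (act f a v).
Proof. exact: (hom_eq (F_hom_d f)). Qed.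

Lemma act_cmp (X Y Z : C) (g : mor Y Z) (f : mor X Y) a v :
  act (g \c f) a v = act g a (act f a v).
Proof. by []. Qed.

Lemma act_id (X : C) a v : act (idm X) a v = v.
Proof. by []. Qed.

Lemma act0 (X Y : C) a v : act (0 : mor X Y) a v = 0.
Proof. by []. Qed.

Lemma actB (X Y : C) (f g : mor X Y) a v : act (f - g) a v = act f a v - act g a v.
Proof. by []. Qed.

Lemma act_add (X Y : C) (f : mor X Y) a v w :
  act f a (v + w) = act f a v + act f a w.
Proof. exact: linearD. Qed.

Lemma act_sum (X Y : C) (I : Type) (s : seq I) (F : I -> mor X Y) a v :
  act (\sum_(i <- s) F i) a v = \sum_(i <- s) act (F i) a v.
Proof. by elim/big_rec2: _ => // i x y _ <-. Qed.

Lemma act_eq (X Y : C) (f g : mor X Y) : f = g -> forall a v, act f a v = act g a v.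
Proof. by move=> ->. Qed.

Definition make_mor (X Y : C) (f : hom (base X) (base Y))
    (fd : forall a v, f a (d X a v) = d Y a (f a v)) : mor X Y :=
  @FHom Re R t (base X) (base Y) f 
    (hom_ext (f := hom_comp f (d X)) (g := hom_comp (d Y) f) fd).

Lemma base_fg (X : C) : fg_projective (base X).
Proof. by split; [apply: F_fin_gen|apply: F_projective]. Qed.

Lemma d_deep (X : C) : deep theta (d X).
Proof. by apply/(deep_d tP) => //; case: X. Qed.

Definition make_obj (V : rep) (Vfg : fg_projective V) (f : hom V V)
    (ff : forall a v, f a (f a v) = t *: v) (fdeep : deep theta f) : C :=
  exist _ (FObj Vfg.1 Vfg.2 ff : F_pi Re t)
    ((deep_d tP (FObj Vfg.1 Vfg.2 ff) theta_ge0).2 fdeep).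

(** Every object needed below (kernels, cokernels, direct summands) is cut out of
    an object (X, d) by an idempotent e of the representation X that need not
    commute with d.  On the image of e the differential is e d, and the condition
    e d e d e = t e says that its square is t.  The condition holds if the image
    of e is stable under d (kernels), and if its kernel is (cokernels). *)
Lemma idempotent_object (X : C) (e : hom (base X) (base X)) :
  (forall a v, e a (e a v) = e a v) ->
  (forall a v, e a (d X a (e a (d X a (e a v)))) = t *: e a v) ->
  exists (Y : C) (i : hom (base Y) (base X)) (p : hom (base X) (base Y)),
  [/\ forall a w, p a (i a w) = w, forall a v, i a (p a v) = e a v &
      forall a w, i a (d Y a w) = e a (d X a (i a w))].
Proof.
move=> ee ede; have [W [i [p [piK ip]]]] := rep_idempotents_split ee.
have Wfg : fg_projective W by apply: retract_fg_projective piK (base_fg X).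
pose f := hom_comp p (hom_comp (d X) i).
have ei a w : e a (i a w) = i a w by rewrite -ip piK.
have ff a w : f a (f a w) = t *: w.
  have iff : i a (f a (f a w)) = t *: i a w.
    by rewrite /f /= !ip -{1}(ei a w) ede ei.
  by rewrite -[LHS]piK iff linearZ /= piK.
have fdeep : deep theta f by apply/deep_compl/deep_compr/d_deep.
by exists (make_obj Wfg ff fdeep), i, p; split=> // a w; rewrite /= ip.
Qed.

End FrobeniusObjects.

(** * The exact structure of F_c *)
Section ExactStructure.
Variables (Re : realType) (R : idomainType) (t : R) (theta : Re).
Hypothesis tP : uniformizing t.
Hypothesis theta_ge0 : 0 <= theta.
Local Open Scope cat_scope.
Local Notation rep := (rep Re t).
Local Notation C := (F_c t theta).
Local Notation ex := (@F_c_exact Re R t theta).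
Local Notation d X := (F_d (base X)).

(** As Z is projective as a representation, the exact sequences of F_c split at
    that level; the splitting need not respect the differentials. *)
Lemma exact_split (X Y Z : C) (f : mor X Y) (g : mor Y Z) : ex f g ->
  exists (r : hom (base Y) (base X)) (s : hom (base Z) (base Y)),
  [/\ forall a v, r a (act f a v) = v, forall a w, act g a (s a w) = w,
      forall a v, act g a (act f a v) = 0 &
      forall a v, act f a (r a v) = v - s a (act g a v)].
Proof.
move=> [fmono fg gepi]; have [s gs] := epi_section (proj2 (base_fg Z)) gepi.
have gf a v : act g a (act f a v) = 0 by apply/fg; exists v.
have [a v|r fr] := @hom_lift _ _ _ _ _ _ (act f)
    (hom_id (base Y) - hom_comp s (act g)) fmono.
  by apply/fg; rewrite linearB /= gs subrr.
exists r, s; split=> // a v; apply: fmono; rewrite fr /=.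
by rewrite [act g a _]gf linear0 subr0.
Qed.

Lemma inflation_retraction (X Y : C) (f : mor X Y) : inflation ex f ->
  exists r : hom (base Y) (base X), forall a v, r a (act f a v) = v.
Proof. by move=> [Z [g /exact_split [r [s [rf _ _ _]]]]]; exists r. Qed.

Lemma deflation_section (Y Z : C) (g : mor Y Z) : deflation ex g ->
  exists s : hom (base Z) (base Y), forall a v, act g a (s a v) = v.
Proof. by move=> [X [f /exact_split [r [s [_ gs _ _]]]]]; exists s. Qed.

(** The kernel of g is the image of the idempotent 1 - s g, which is stable under
    the differential because g commutes with it. *)
Lemma deflation_of_section (Y Z : C) (g : mor Y Z) (s : hom (base Z) (base Y)) :
  (forall a v, act g a (s a v) = v) -> deflation ex g.
Proof.
move=> gs; pose e := hom_id (base Y) - hom_comp s (act g).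
have eE a v : e a v = v - s a (act g a v) by [].
have ge a v : act g a (e a v) = 0 by rewrite eE linearB /= gs subrr.
have e1 a v : act g a v = 0 -> e a v = v by move=> gv; rewrite eE gv linear0 subr0.
have ede a v : e a (d Y a (e a v)) = d Y a (e a v).
  by apply: e1; rewrite act_d ge linear0.
have [||X [i [p [piK ip id]]]] := idempotent_object tP theta_ge0 (e := e).
- by move=> a v; apply: e1.
- by move=> a v; rewrite !ede F_sq.
have ei a w : e a (i a w) = i a w by rewrite -ip piK.
have fd a w : i a (d X a w) = d Y a (i a w) by rewrite id -{1}ei ede ei.
exists X, (make_mor fd); split=> /=.
- by move=> a v w vw; rewrite -[v]piK vw piK.
- move=> a w; split=> [gw|[v <-]]; first by exists (p a w); rewrite ip e1.
  by rewrite -ei; apply: ge.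
- by move=> a w; exists (s a w); apply: gs.
Qed.

(** Dually, the cokernel of f is the image of 1 - f r; here it is the kernel of
    this idempotent, the image of f, that is stable under the differential. *)
Lemma inflation_of_retraction (X Y : C) (f : mor X Y) (r : hom (base Y) (base X)) :
  (forall a v, r a (act f a v) = v) -> inflation ex f.
Proof.
move=> rf; pose e := hom_id (base Y) - hom_comp (act f) r.
have eE a v : e a v = v - act f a (r a v) by [].
have ef a v : e a (act f a v) = 0 by rewrite eE rf subrr.
have eB a v w : e a (v - w) = e a v - e a w by exact: linearB.
have ede a v : e a (d Y a (e a v)) = e a (d Y a v).
  by rewrite [e a v]eE [d Y a _]linearB eB -(act_d f) ef subr0.
have ee a v : e a (e a v) = e a v by rewrite [X in e a X]eE eB ef subr0.
have [||Z [i [p [piK ip id]]]] := idempotent_object tP theta_ge0 (e := e).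
- exact: ee.
- by move=> a v; rewrite ede F_sq -[e a v in RHS]ee; apply: linearZ.
have gd a w : p a (d Y a w) = d Z a (p a w).
  by rewrite -[RHS]piK id !ip ede -ip piK.
exists Z, (make_mor gd); split=> /=.
- by move=> a v w vw; rewrite -[v]rf [act f a v]vw rf.
- move=> a w; split=> [pw|[v <-]].
    exists (r a w); apply/eqP; rewrite eq_sym -subr_eq0 -eE -ip.
    by rewrite [p a w]pw linear0.
  by rewrite -[LHS]piK ip [e a _]ef linear0.
- by move=> a w; exists (i a w); apply: piK.
Qed.

Lemma exact_is_kernel (X Y Z : C) (f : mor X Y) (g : mor Y Z) :
  ex f g -> is_kernel f g /\ is_cokernel f g.
Proof.
move=> /exact_split [r [s [rf gs gf fr]]].
have gf0 : g \c f = 0 by apply: act_inj => a v; rewrite act_cmp gf.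
split; split=> // W h h0.
  have fk a v : act f a (r a (act h a v)) = act h a v.
    by rewrite fr -act_cmp h0 act0 linear0 subr0.
  have kd a v : hom_comp r (act h) a (d W a v) = d X a (hom_comp r (act h) a v).
    by rewrite /= -[RHS]rf act_d fk -act_d.
  exists (make_mor kd); split; first by apply: act_inj => a v; apply: fk.
  move=> k' /act_eq fk'; apply: act_inj => a v.
  by apply: etrans (congr1 (r a) (esym (fk' a v))) _; apply: rf.
have kg a v : act h a (s a (act g a v)) = act h a v.
  have -> : s a (act g a v) = v - act f a (r a v) by rewrite fr subKr.
  by rewrite linearB -act_cmp h0 act0 subr0.
have kd a v : hom_comp (act h) s a (d Z a v) = d W a (hom_comp (act h) s a v).
  by rewrite /= -{1}[v]gs -act_d kg act_d.
exists (make_mor kd); split; first by apply: act_inj => a v; apply: kg.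
move=> k' /act_eq k'g; apply: act_inj => a v.
by apply: etrans (esym (k'g a (s a v))) _; rewrite act_cmp gs.
Qed.

Lemma is_iso_act (X Y : C) (f : mor X Y) : is_iso f -> exists g : mor Y X,
  (forall a v, act g a (act f a v) = v) /\ (forall a v, act f a (act g a v) = v).
Proof.
move=> [g [/act_eq gf /act_eq fg]].
by exists g; split=> a v; [apply: gf|apply: fg].
Qed.

Lemma exact_isomorphism (X Y Z X' Y' Z' : C) (f : mor X Y) (g : mor Y Z)
    (f' : mor X' Y') (g' : mor Y' Z')
    (a : mor X X') (b : mor Y Y') (c : mor Z Z') :
  is_iso a -> is_iso b -> is_iso c ->
  f' \c a = b \c f -> g' \c b = c \c g -> ex f g -> ex f' g'.
Proof.
move=> /is_iso_act [a' [a'a aa']] /is_iso_act [b' [b'b bb']].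
move=> /is_iso_act [c' [c'c cc']] /act_eq faE /act_eq gbE [fmono fg gepi].
have f'E p v : act f' p v = act b p (act f p (act a' p v)).
  by rewrite -[v in LHS]aa'; apply: faE.
have g'E p v : act g' p v = act c p (act g p (act b' p v)).
  by rewrite -[v in LHS]bb'; apply: gbE.
split=> p.
- move=> v w; rewrite -!/(act f' p _) !f'E => /(congr1 (act b' p)).
  by rewrite !b'b => /fmono /(congr1 (act a p)); rewrite !aa'.
- move=> w; rewrite -/(act g' p _) g'E; split=> [cw|[v <-]].
    have /fg [v fv] : act g p (act b' p w) = 0.
      by rewrite -[LHS]c'c cw linear0.
    by exists (act a p v); rewrite -/(act f' p _) f'E a'a [act f p v]fv bb'.
  rewrite -/(act f' p _) f'E b'b.
  have -> : act g p (act f p (act a' p v)) = 0 by apply/fg; exists (act a' p v).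
  exact: linear0.
- move=> w; have [v gv] := gepi p (act c' p w).
  by exists (act b p v); rewrite -/(act g' p _) g'E b'b [act g p v]gv cc'.
Qed.

Section Sum.
Variables (I : finType) (X : I -> C).

Program Definition sum_d :
    hom (dsum (fun i => base (X i))) (dsum (fun i => base (X i))) :=
  @make_hom _ _ _ (dsum _) (dsum _) (fun a v i => d (X i) a (v i)) _ _.
Next Obligation. by move=> a c u v; apply: dsum_ext => i; apply: linearP. Qed.
Next Obligation. by move=> a b alpha h v; apply: dsum_ext => i; apply: hom_nat. Qed.

Lemma sum_fg : fg_projective (dsum (fun i => base (X i))).
Proof. by apply: dsum_fg_projective => i; apply: base_fg. Qed.

Lemma sum_sq a v : sum_d a (sum_d a v) = t *: v.
Proof. by apply: dsum_ext => i; apply: F_sq. Qed.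

Lemma sum_deep : deep theta sum_d.
Proof.
move=> a b h v; have w i := cid (d_deep tP theta_ge0 h (v i)).
by exists (fun i => sval (w i)); apply: dsum_ext => i; apply: (svalP (w i)).
Qed.

Definition sum_obj : C := make_obj tP theta_ge0 sum_fg sum_sq sum_deep.

Program Definition sum_in i : mor (X i) sum_obj :=
  @make_mor _ _ _ _ (X i) sum_obj (dsum_in (fun i => base (X i)) i) _.
Next Obligation.
move=> i a v; apply: dsum_ext => j /=; rewrite /linear_fun.
have [<-|ij] := eqVneq i j; first by rewrite !dsum_inE.
by rewrite !dsum_in_ne // linear0.
Qed.

Program Definition sum_out i : mor sum_obj (X i) :=
  @make_mor _ _ _ _ sum_obj (X i) (dsum_out (fun i => base (X i)) i) _.
Next Obligation. by []. Qed.

Lemma sum_outK i : sum_out i \c sum_in i = idm (X i).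
Proof. by apply: act_inj => a v; apply: dsum_inE. Qed.

Lemma sum_out_in i j : i != j -> sum_out j \c sum_in i = 0.
Proof. by move=> ij; apply: act_inj => a v; apply: dsum_in_ne. Qed.

Lemma sum_id : \sum_i sum_in i \c sum_out i = idm sum_obj.
Proof.
apply: act_inj => a v; rewrite act_sum [RHS]dsum_sum_in.
by apply: eq_bigr.
Qed.

End Sum.

Lemma binary_sum (A B : C) : exists S, is_sum A B S.
Proof.
pose X (b : bool) := if b then A else B.
exists (sum_obj X), (sum_in X true), (sum_in X false).
exists (sum_out X true), (sum_out X false).
split; [exact: (sum_outK X true)|exact: (sum_outK X false)| | |].
- exact: (@sum_out_in _ X false true).
- exact: (@sum_out_in _ X true false).
- by have := sum_id X; rewrite big_bool.
Qed.

Lemma F_c_additive : additive_category C.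
Proof.
split; last exact: binary_sum.
exists (sum_obj (fun i : void => match i return C with end)).
by rewrite /is_zero -sum_id big1 // => -[].
Qed.

(** The pushout is the cokernel of u = (f, - g), an inflation because the
    retraction r of f gives one of u.  The map p2 + g r p1 kills u and is the
    identity on Y, so it induces a retraction of the pushout onto Y. *)
Lemma F_c_pushout (Z X Y : C) (f : mor Z X) (g : mor Z Y) : inflation ex f ->
  exists P (p : mor X P) (q : mor Y P), is_pushout p q f g /\ inflation ex q.
Proof.
move=> /inflation_retraction [r rf].
have [B [i1 [i2 [p1 [p2 bi]]]]] := binary_sum X Y.
have [/act_eq p1i1 /act_eq p2i2 /act_eq p1i2 /act_eq p2i1 _] := bi.
set u := i1 \c f - i2 \c g.
have p1u a v : act p1 a (act u a v) = act f a v.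
  by rewrite actB linearB [X in X - _]p1i1 [X in _ - X]p1i2 subr0.
have p2u a v : act p2 a (act u a v) = - act g a v.
  by rewrite actB linearB [X in X - _]p2i1 [X in _ - X]p2i2 sub0r.
have [|P [q uq]] := @inflation_of_retraction Z B u (hom_comp r (act p1)).
  by move=> a v; rewrite /= p1u rf.
exists P, (q \c i1), (q \c i2); split.
  by apply: pushout_of_cokernel bi (exact_is_kernel uq).2.
have [r' [s [_ _ _ ur]]] := exact_split uq.
pose rho := act p2 + hom_comp (act g) (hom_comp r (act p1)).
have rhoE a v : rho a v = act p2 a v + act g a (r a (act p1 a v)) by [].
have rhou a v : rho a (act u a v) = 0 by rewrite rhoE p1u p2u rf addNr.
apply: (@inflation_of_retraction _ _ _ (hom_comp rho s)) => a v.
rewrite act_cmp /=.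
have -> : s a (act q a (act i2 a v)) = act i2 a v - act u a (r' a (act i2 a v)).
  by rewrite ur subKr.
rewrite [LHS](linearB (rho a)) rhou subr0 rhoE [X in X + _]p2i2.
by rewrite -(act_cmp p1) p1i2 act0 !linear0 addr0.
Qed.

(** The pullback is the kernel of u = (f, - g).  A section of its projection to Y
    sends y to (s g y, y), which lies in this kernel. *)
Lemma F_c_pullback (X Y Z : C) (f : mor X Z) (g : mor Y Z) : deflation ex f ->
  exists P (p : mor P X) (q : mor P Y), is_pullback p q f g /\ deflation ex q.
Proof.
move=> /deflation_section [s fs].
have [B [i1 [i2 [p1 [p2 bi]]]]] := binary_sum X Y.
have [/act_eq p1i1 /act_eq p2i2 /act_eq p1i2 /act_eq p2i1 _] := bi.
set u := f \c p1 - g \c p2.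
have ui1 a v : act u a (act i1 a v) = act f a v.
  by rewrite actB !act_cmp [act p1 a _]p1i1 [act p2 a _]p2i1 linear0 subr0.
have ui2 a v : act u a (act i2 a v) = - act g a v.
  by rewrite actB !act_cmp [act p1 a _]p1i2 [act p2 a _]p2i2 linear0 sub0r.
have [|P [k ku]] := @deflation_of_section B Z u (hom_comp (act i1) s).
  by move=> a v; apply: etrans (ui1 _ _) (fs _ _).
exists P, (p1 \c k), (p2 \c k); split.
  by apply: pullback_of_kernel bi (exact_is_kernel ku).1.
have [r [s' [_ _ _ kr]]] := exact_split ku.
apply: (@deflation_of_section _ _ _
  (hom_comp r (hom_comp (act i1) (hom_comp s (act g)) + act i2))) => a v.
set w := act i1 a (s a (act g a v)) + act i2 a v.
have uw : act u a w = 0 by rewrite act_add ui1 ui2 fs subrr.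
have -> : act (p2 \c k) a ((hom_comp r (hom_comp (act i1) (hom_comp s (act g)) +
    act i2)) a v) = act p2 a (act k a (r a w)) by [].
by rewrite kr uw linear0 subr0 act_add [X in X + _]p2i1 [X in _ + X]p2i2 add0r.
Qed.

Theorem F_c_exact_category : exact_category ex.
Proof.
split.
- exact: F_c_additive.
- exact: exact_is_kernel.
- exact: exact_isomorphism.
- by move=> X; apply: (@inflation_of_retraction _ _ _ (hom_id _)).
- by move=> X; apply: (@deflation_of_section _ _ _ (hom_id _)).
- move=> X Y Z g f /inflation_retraction [r rf] /inflation_retraction [s sg].
  apply: (@inflation_of_retraction _ _ _ (hom_comp r s)) => a v.
  by rewrite act_cmp /= sg rf.
- move=> X Y Z g f /deflation_section [r fr] /deflation_section [s gs].
  apply: (@deflation_of_section _ _ _ (hom_comp r s)) => a v.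
  by rewrite act_cmp /= fr gs.
- exact: F_c_pushout.
- exact: F_c_pullback.
Qed.

Lemma sum_projective (I : finType) (X : I -> C) :
  (forall i, projective_object ex (X i)) -> projective_object ex (sum_obj X).
Proof.
move=> Xproj Y Z g h gdefl.
have k i := cid (Xproj i Y Z g (h \c sum_in X i) gdefl).
exists (\sum_i sval (k i) \c sum_out X i).
rewrite cmp_sumr -[RHS]cmpm1 -sum_id cmp_sumr; apply: eq_bigr => i _.
by rewrite cmpA (svalP (k i)) cmpA.
Qed.

Lemma sum_injective (I : finType) (X : I -> C) :
  (forall i, injective_object ex (X i)) -> injective_object ex (sum_obj X).
Proof.
move=> Xinj Y Z f h finfl.
have k i := cid (Xinj i Y Z f (sum_out X i \c h) finfl).
exists (\sum_i sum_in X i \c sval (k i)).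
rewrite cmp_suml -[RHS]cmp1m -sum_id cmp_suml; apply: eq_bigr => i _.
by rewrite -cmpA (svalP (k i)) cmpA.
Qed.

Lemma F_c_idempotents_split : idempotents_split C.
Proof.
move=> X e /act_eq ee; have eK a v : act e a (act e a v) = act e a v := ee a v.
have [||Y [i [p [piK ip id]]]] := idempotent_object tP theta_ge0 (e := act e).
- exact: ee.
- by move=> a v; rewrite (act_d e (act e a v)) eK F_sq linearZ eK.
have ei a w : act e a (i a w) = i a w by rewrite -ip piK.
have fd a w : i a (d Y a w) = d X a (i a w) by rewrite id act_d ei.
have gd a w : p a (d X a w) = d Y a (p a w).
  by rewrite -[RHS]piK fd ip -act_d -ip piK.
exists Y, (make_mor fd), (make_mor gd).
by split; apply: act_inj; [apply: piK|apply: ip].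
Qed.

End ExactStructure.

(** * The objects E(x, y) *)
Section EObjects.
Variables (Re : realType) (R : idomainType) (t : R).
Local Notation rep := (rep Re t).
Local Notation P := (P (Re := Re) t).
Implicit Types (V W : rep).

Lemma rep_map0 V a (h : arc a a 0) v : rep_map V h v = v.
Proof.
have h0 : arc a a (tau Re * 0%:R) by rewrite mulr0.
rewrite -[RHS](scale1r v) -(expr0 t) -(rep_turn h0).
by move: h h0; rewrite mulr0 => h h0; rewrite (Prop_irrelevance h h0).
Qed.

Lemma rep_map_comp V a b c alpha beta gamma (hab : arc a b alpha)
    (hbc : arc b c beta) (hac : arc a c gamma) v :
  gamma = alpha + beta -> rep_map V hbc (rep_map V hab v) = rep_map V hac v.
Proof. by rewrite addrC => gE; subst gamma; apply: rep_comp. Qed.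

Lemma rep_map_eq V a b alpha beta (h : arc a b alpha) (h' : arc a b beta) v :
  alpha = beta -> rep_map V h v = rep_map V h' v.
Proof. by move=> aE; subst beta; rewrite (Prop_irrelevance h h'). Qed.

Section Generators.
Variables (x y : Re) (xy : x <= y <= x + tau Re).
Local Notation Exy := (E t x y xy : F_obj Re t).
Local Notation d := (F_d Exy).

Definition gen_x : Exy (cls x) :=
  dsum_in (fun i => P (E_pt x y i)) false (cls x) (e_ t (arc0 (cls x))).

Definition gen_y : Exy (cls y) :=
  dsum_in (fun i => P (E_pt x y i)) true (cls y) (e_ t (arc0 (cls y))).

Lemma E_d_false a (v : Exy a) : d a v false = beta_star t xy a (v true).
Proof. by rewrite [LHS]mxhomE big_bool; apply: addr0. Qed.

Lemma E_d_true a (v : Exy a) : d a v true = alpha_star t xy a (v false).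
Proof. by rewrite [LHS]mxhomE big_bool; apply: add0r. Qed.

Lemma d_gen_x : d _ gen_x = rep_map Exy (E_alpha xy) gen_y.
Proof.
rewrite hom_nat e_map; apply: dsum_ext => -[].
  rewrite E_d_true dsum_inE [gen_x _]dsum_inE /alpha_star P_homEarc e_map /e_.
  congr (_ ^+ turns _).
  by rewrite addrC.
rewrite E_d_false /gen_x !dsum_in_ne // linear0.
by [].
Qed.

Lemma d_gen_y : d _ gen_y = rep_map Exy (E_beta xy) gen_x.
Proof.
rewrite hom_nat e_map; apply: dsum_ext => -[].
  by rewrite E_d_true /gen_y !dsum_in_ne // linear0.
rewrite E_d_false dsum_inE [gen_y _]dsum_inE /beta_star P_homEarc e_map /e_.
congr (_ ^+ turns _).
by rewrite addrC.
Qed.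

(** The two generators are free, so a morphism from E(x, y) only has to respect
    that d maps each of them to a translate of the other. *)
Lemma E_hom (X : F_obj Re t) (v : X (cls x)) (w : X (cls y)) :
  rep_map X (E_alpha xy) w = F_d X _ v -> rep_map X (E_beta xy) v = F_d X _ w ->
  exists f : F_hom Exy X, f _ gen_x = v /\ f _ gen_y = w.
Proof.
move=> wE vE.
pose g i : hom (P (E_pt x y i)) X :=
  if i is true then P_hom (w : X (E_pt x y true))
  else P_hom (v : X (E_pt x y false)).
have [f fsum] := dsum_in_hom g.
have fE a u : f a u = P_hom w a (u true) + P_hom v a (u false).
  by rewrite fsum big_bool.
have ga : hom_comp (P_hom w) (alpha_star t xy) = hom_comp (F_d X) (P_hom v).
  by apply: P_hom_inj; rewrite /= P_homE P_homE -wE; apply: P_homEarc.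
have gb : hom_comp (P_hom v) (beta_star t xy) = hom_comp (F_d X) (P_hom w).
  by apply: P_hom_inj; rewrite /= P_homE P_homE -vE; apply: P_homEarc.
have fd : hom_comp f (F_d Exy) = hom_comp (F_d X) f.
  apply: hom_ext => a u; rewrite /hom_comp /= !fE linearD.
  rewrite [X in P_hom w a X]E_d_true [X in P_hom v a X]E_d_false addrC.
  by congr (_ + _); [apply: (hom_eq gb)|apply: (hom_eq ga)].
exists (FHom fd); split; apply: etrans (fE _ _) _.
  by rewrite [gen_x true]dsum_in_ne // linear0 add0r [gen_x false]dsum_inE P_homE.
by rewrite [gen_y false]dsum_in_ne // linear0 addr0 [gen_y true]dsum_inE P_homE.
Qed.

Lemma E_hom_inj V (f g : hom Exy V) :
  f _ gen_x = g _ gen_x -> f _ gen_y = g _ gen_y -> f = g.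
Proof.
move=> fgx fgy.
have fgi i : hom_comp f (dsum_in _ i) = hom_comp g (dsum_in _ i).
  by case: i; apply: P_hom_inj.
apply: hom_ext => a v; rewrite [v]dsum_sum_in !linear_sum.
by apply: eq_bigr => i _; apply: (hom_eq (fgi i)).
Qed.

Lemma E_deep theta : theta <= y - x -> theta <= x + tau Re - y -> deep theta d.
Proof.
move=> ya yb; apply/deep_dsum => j i.
apply: (@deep_eq _ _ _ _ _ _ (E_entry t xy j i)).
  move=> a v; symmetry; apply: etrans (mxhomE _ _ _) _.
  rewrite (bigD1 i) //= [dsum_in_fun _ i]dsum_inE big1 ?addr0 // => k.
  by rewrite eq_sym => ik; rewrite [dsum_in_fun _ k]dsum_in_ne ?linear0.
by case: i j => -[]; [exact: deep0|exact: deep_P_hom|exact: deep_P_hom|exact: deep0].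
Qed.

End Generators.

(** Exchanging the two generators identifies E(x, y) with E(y, x + 2 pi).  As
    x and x + 2 pi are equal points of the circle but different real numbers, the
    generators are transported along an arc of length zero. *)
Lemma E_swap (x y z : Re) (xy : x <= y <= x + tau Re) (yz : y <= z <= y + tau Re) :
  z = x + tau Re -> @isomorphic (F_pi Re t) (E t x y xy) (E t y z yz).
Proof.
move=> zE; have xz : cls x = cls z.
  apply/cls_eq; rewrite /circle_rel zE opprD addNKr mulNr.
  by rewrite mulfV ?rpredN ?rpred1 // gt_eqF ?tau_gt0.
have h : arc (cls z) (cls x) 0 by rewrite xz arc0.
have h' : arc (cls x) (cls z) 0 by rewrite xz arc0.
have [||f [fx fy]] :=
  @E_hom _ _ xy (E t y z yz) (rep_map _ h (gen_y yz)) (gen_x yz).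
- rewrite -hom_nat d_gen_y (rep_map_comp _ _ (E_alpha xy)) // zE; ring.
- rewrite d_gen_x (rep_map_comp _ _ (E_alpha yz)) // zE; ring.
have [||g [gx gy]] :=
  @E_hom _ _ yz (E t x y xy) (gen_y xy) (rep_map _ h' (gen_x xy)).
- rewrite d_gen_y (rep_map_comp _ _ (E_beta xy)) // zE; ring.
- rewrite -hom_nat d_gen_x (rep_map_comp _ _ (E_beta yz)) // zE; ring.
exists f, g; split; apply: F_hom_ext; apply: E_hom_inj => /=.
- by rewrite fx -hom_nat gy (rep_map_comp _ _ (arc0 _)) ?addr0 // rep_map0.
- by rewrite fy gx.
- by rewrite gx fy.
- by rewrite gy -hom_nat fx (rep_map_comp _ _ (arc0 _)) ?addr0 // rep_map0.
Qed.

End EObjects.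

(** * The objects E(x, x + theta) as projectives and injectives of F_c *)
Section Frobenius.
Variables (Re : realType) (R : idomainType) (t : R) (c theta : Re).
Hypothesis tP : uniformizing t.
Hypotheses (c_gt0 : 0 < c) (theta_gt0 : 0 < theta) (c_theta : c + theta = pi).
Let theta_ge0 : 0 <= theta := ltW theta_gt0.
Local Open Scope cat_scope.
Local Notation rep := (rep Re t).
Local Notation P := (P (Re := Re) t).
Local Notation C := (F_c t theta).
Local Notation ex := (@F_c_exact Re R t theta).
Local Notation d X := (F_d (base X)).
Local Notation x_range := (E_range c_gt0 theta_gt0 c_theta).
Local Notation E1 x := (E t x (x + theta) (x_range x)).

Lemma E_in_F_c (x y : Re) (xy : x <= y <= x + tau Re) :
  theta <= y - x -> theta <= x + tau Re - y -> in_F_c theta (E t x y xy).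
Proof. by move=> h1 h2; apply/(deep_d tP) => //; apply: E_deep. Qed.

Lemma E1_in_F_c x : in_F_c theta (E1 x).
Proof.
have := c_gt0; have := theta_gt0 => theta0 c0.
by apply: E_in_F_c; rewrite /tau -?c_theta; lra.
Qed.

Lemma E2_in_F_c x : in_F_c theta (E t (x + theta) (x + tau Re)
  (E_range' c_gt0 theta_gt0 c_theta x)).
Proof.
have := c_gt0; have := theta_gt0 => theta0 c0.
by apply: E_in_F_c; rewrite /tau -?c_theta; lra.
Qed.

Definition Ec x : C := exist _ (E1 x) (E1_in_F_c x).

Local Notation gx x := (gen_x t (x_range x)).
Local Notation gy x := (gen_y t (x_range x)).

Lemma structure_map_inj (X : C) a b alpha (h : arc a b alpha) :
  injective (rep_map (base X) h).
Proof.
have [t0 _ _] := tP; apply: fg_projective_map_inj => //; exact: base_fg.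
Qed.

(** The objects E(x, x + theta) represent the functor that takes X to its value at
    [x].  The image v of e_x may be arbitrary: since d has depth at least theta,
    d v comes from a unique element at [x + theta], which has to be the image of
    the other generator. *)
Lemma hom_from_Ec x (X : C) (v : base X (cls x)) :
  exists f : mor (Ec x) X, act f _ (gx x) = v.
Proof.
have hth : arc (cls (x + theta)) (cls x) theta.
  have := E_alpha (x_range x); by rewrite addrAC subrr add0r.
have [w wE] := d_deep tP theta_ge0 hth v.
have wE' : rep_map (base X) (E_alpha (x_range x)) w = d X _ v.
  by rewrite -wE; apply: rep_map_eq; ring.
have [||f [fx fy]] := @E_hom _ _ _ _ _ (x_range x) (base X) v w.
- exact: wE'.
- (* After a further path of length theta both sides become t v. *)
  apply: (@structure_map_inj _ _ _ _ (E_alpha (x_range x))).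
  have ht : arc (cls x) (cls x) (tau Re * 1%:R).
    have -> : tau Re * 1%:R = x + tau Re - (x + theta) + (x + theta - x) by ring.
    exact: arcD (E_beta (x_range x)) (E_alpha (x_range x)).
  rewrite (rep_map_comp _ _ ht); last by ring.
  by rewrite rep_turn hom_nat wE' F_sq.
by exists f.
Qed.

Lemma hom_from_Ec_inj x (X : C) (f g : mor (Ec x) X) :
  act f _ (gx x) = act g _ (gx x) -> f = g.
Proof.
move=> fgx; apply: F_hom_ext; apply: E_hom_inj; first exact: fgx.
apply: (@structure_map_inj _ _ _ _ (E_alpha (x_range x))).
have dE : rep_map (base (Ec x)) (E_alpha (x_range x)) (gy x) = d (Ec x) _ (gx x).
  exact/esym/d_gen_x.
have actE (h : mor (Ec x) X) :
    rep_map (base X) (E_alpha (x_range x)) (act h _ (gy x)) =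
    d X _ (act h _ (gx x)) by rewrite hom_nat dE act_d.
by apply: etrans (actE f) _; rewrite fgx; apply: esym (actE g).
Qed.

(** Elements lift through deflations, so the functor represented by
    E(x, x + theta) takes deflations to surjections. *)
Lemma Ec_projective x : projective_object ex (Ec x).
Proof.
move=> Y Z g h /deflation_section [s gs].
have [k kE] := hom_from_Ec (s _ (act h _ (gx x))).
by exists k; apply: hom_from_Ec_inj; rewrite act_cmp kE gs.
Qed.

Lemma alpha_star_inj x a : injective (alpha_star t (x_range x) a).
Proof.
have [t0 _ _] := tP => r s.
by move/(mulIf (mulf_neq0 (expf_neq0 _ t0) (expf_neq0 _ t0))).
Qed.

(** Dually, a morphism into E(x, x + theta) is the same as a morphism f of
    representations into its component at [x + theta].  The component at [x] has to
    become f d under the inclusion [alpha_star], whose image consists of the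
    elements that come from the point theta before; f d takes its values there,
    as d has depth at least theta. *)
Lemma hom_to_Ec x (X : C) (f : hom (base X) (P (cls (x + theta)))) :
  exists h : mor X (Ec x), forall a v, act h a v true = f a v.
Proof.
have [|a v|k kE] := @hom_lift _ _ _ _ _ _ (alpha_star t (x_range x))
    (hom_comp f (d X)).
- exact: alpha_star_inj.
- have [a' h] := arc_back a theta_ge0.
  have [u uE] := d_deep tP theta_ge0 h v.
  have /andP[d0 /eqP a'E] := arc_dist (cls (x + theta)) a'.
  have hxa : arc (cls x) a (dist (cls (x + theta)) a').
    have /andP[_ /eqP ->] := h; rewrite {1}a'E rotD (addrC (dist _ _)) -rotD.
    by rewrite (rot_cls (x + theta)) addrK /arc d0 eqxx.
  exists ((f a' u : R) *: e_ t hxa).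
  apply: etrans (linearZ _ _) _; rewrite P_hom_e.
  rewrite /= -uE -hom_nat [f a' u in RHS](e_gen (arc_dist _ _)) ?dist_lt //.
  rewrite linearZ e_map /e_.
  rewrite (_ : x + theta - x + _ = dist (cls (x + theta)) a' + theta) //.
  by ring.
pose g i : hom (base X) (P (E_pt x (x + theta) i)) :=
  if i is true then f else k.
have [h hE] := dsum_out_hom g.
have hd a v : h a (d X a v) = d (Ec x) a (h a v).
  apply: dsum_ext => -[]; rewrite hE.
    by apply: etrans (esym (kE a v)) _; rewrite [RHS]E_d_true hE.
  rewrite [RHS]E_d_false hE; apply: alpha_star_inj; apply: etrans (kE _ _) _.
  rewrite /= F_sq linearZ; apply/esym/P_hom_t; ring.
by exists (@make_mor _ _ _ _ X (Ec x) h hd) => a v; apply: hE.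
Qed.

Lemma hom_to_Ec_inj x (X : C) (f g : mor X (Ec x)) :
  (forall a v, act f a v true = act g a v true) -> f = g.
Proof.
move=> fg; apply: act_inj => a v; apply: dsum_ext => -[]; first exact: fg.
apply: (@alpha_star_inj x a).
have E (h : mor X (Ec x)) : alpha_star t (x_range x) a (act h a v false) =
    act h a (d X a v) true by rewrite act_d [RHS]E_d_true.
by rewrite !E fg.
Qed.

(** Morphisms of representations extend along inflations, because inflations
    have a retraction at this level. *)
Lemma Ec_injective x : injective_object ex (Ec x).
Proof.
move=> X Y f h /inflation_retraction [r rf].
pose out := dsum_out (fun i => P (E_pt x (x + theta) i)) true.
have [k kE] := @hom_to_Ec x Y (hom_comp (hom_comp out (act h)) r).
exists k; apply: hom_to_Ec_inj => a v.
by rewrite act_cmp kE /= rf.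
Qed.

(** The summands P of the representation underlying X give elements of X, hence
    morphisms from the corresponding objects E(x, x + theta), jointly onto. *)
Lemma Ec_cover (X : C) : exists (I : finType) (x : I -> Re)
  (g : mor (sum_obj tP theta_ge0 (fun i => Ec (x i))) X), deflation ex g.
Proof.
have [I [z]] := fg_projective_sumP (uniformizing_local tP) (base_fg X).
have [x -> [phi [psi [_ phiK]]]] : exists x : I -> Re, z = fun i => cls (x i).
  by exists (fun i => repr (z i)); apply/funext => i; rewrite cls_repr.
pose u i : base X (cls (x i)) :=
  phi _ (dsum_in (fun i => P (cls (x i))) i _ (e_ t (arc0 _))).
have f i := cid (hom_from_Ec (u i)).
exists I, x, (\sum_i sval (f i) \c sum_out tP theta_ge0 _ i).
pose s i : hom (P (cls (x i))) (base (Ec (x i))) :=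
  dsum_in (fun j => P (E_pt (x i) (x i + theta) j)) false.
have [s' s'E] := dsum_out_hom (fun i =>
  hom_comp (s i) (dsum_out (fun i => P (cls (x i))) i)).
apply: (@deflation_of_section _ _ _ _ tP theta_ge0
  (sum_obj tP theta_ge0 (fun i => Ec (x i))) X _ (hom_comp s' psi)) => a v.
rewrite act_sum -[RHS]phiK [psi a v in RHS]dsum_sum_in linear_sum.
apply: eq_bigr => i _; rewrite act_cmp.
have fs : hom_comp (act (sval (f i))) (s i) = hom_comp phi (dsum_in _ i).
  by apply: P_hom_inj; apply: (svalP (f i)).
apply: etrans (hom_eq fs _); congr (act (sval (f i)) a _).
exact: s'E.
Qed.

(** The points are shifted by theta because it is the second component of
    E(x, x + theta) that receives a given projection of X. *)
Lemma Ec_hull (X : C) : exists (I : finType) (x : I -> Re)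
  (f : mor X (sum_obj tP theta_ge0 (fun i => Ec (x i)))), inflation ex f.
Proof.
have [I [z]] := fg_projective_sumP (uniformizing_local tP) (base_fg X).
have [x -> [phi [psi [_ phiK]]]] :
    exists x : I -> Re, z = fun i => cls (x i + theta).
  by exists (fun i => repr (z i) - theta); apply/funext => i; rewrite subrK cls_repr.
have f i := cid (@hom_to_Ec (x i) X
  (hom_comp (dsum_out (fun i => P (cls (x i + theta))) i) psi)).
exists I, x, (\sum_i sum_in tP theta_ge0 (fun i => Ec (x i)) i \c sval (f i)).
pose r i : hom (base (Ec (x i))) (P (cls (x i + theta))) :=
  dsum_out (fun j => P (E_pt (x i) (x i + theta) j)) true.
have [r' r'E] := dsum_out_hom (fun i =>
  hom_comp (r i) (dsum_out (fun i => base (Ec (x i))) i)).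
apply: (@inflation_of_retraction _ _ _ _ tP theta_ge0 X
  (sum_obj tP theta_ge0 (fun i => Ec (x i))) _ (hom_comp phi r')) => a v.
rewrite -[RHS]phiK; congr (phi a _); apply: dsum_ext => i; rewrite r'E.
apply: etrans (svalP (f i) a v); congr (_ true).
have -> : act (sval (f i)) a v = act (sum_out tP theta_ge0 (fun i => Ec (x i)) i \c
    (\sum_j sum_in tP theta_ge0 (fun i => Ec (x i)) j \c sval (f j))) a v.
  congr (act _ a v); rewrite cmp_sumr (big_only1 i) // ?cmpA ?sum_outK ?cmp1m //.
  by move=> j ji _; rewrite cmpA sum_out_in // cmp0m.
by [].
Qed.

Lemma sum_Ec_projective (I : finType) (x : I -> Re) :
  projective_object ex (sum_obj tP theta_ge0 (fun i => Ec (x i))).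
Proof. by apply: sum_projective => i; apply: Ec_projective. Qed.

Lemma sum_Ec_injective (I : finType) (x : I -> Re) :
  injective_object ex (sum_obj tP theta_ge0 (fun i => Ec (x i))).
Proof. by apply: sum_injective => i; apply: Ec_injective. Qed.

Lemma projective_retract (X : C) : projective_object ex X ->
  exists (I : finType) (x : I -> Re),
    retract X (sum_obj tP theta_ge0 (fun i => Ec (x i))).
Proof.
move=> Xproj; have [I [x [g gdefl]]] := Ec_cover X.
by have [s gs] := Xproj _ _ g (idm X) gdefl; exists I, x, s, g.
Qed.

Lemma injective_retract (X : C) : injective_object ex X ->
  exists (I : finType) (x : I -> Re),
    retract X (sum_obj tP theta_ge0 (fun i => Ec (x i))).
Proof.
move=> Xinj; have [I [x [f finfl]]] := Ec_hull X.
by have [r rf] := Xinj _ _ f (idm X) finfl; exists I, x, f, r.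
Qed.

(** A projective object is a retract of a sum of objects E(x, x + theta), and such
    a sum is injective; likewise with projective and injective exchanged. *)
Theorem F_c_frobenius : frobenius ex.
Proof.
split.
- exact: F_c_exact_category.
- move=> X; have [I [x [g gdefl]]] := Ec_cover X.
  by eexists; exists g; split; first exact: sum_Ec_projective.
- move=> X; have [I [x [f finfl]]] := Ec_hull X.
  by eexists; exists f; split; first exact: sum_Ec_injective.
move=> X; split.
  move=> /projective_retract [I [x Xr]].
  exact: retract_injective Xr (@sum_Ec_injective I x).
move=> /injective_retract [I [x Xr]].
exact: retract_projective Xr (@sum_Ec_projective I x).
Qed.

Program Definition lin_d (X : C) (p q : R) : mor X X :=
  @make_mor _ _ _ _ X X (scale_hom _ p + hom_comp (scale_hom _ q) (d X)) _.
Next Obligation.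
move=> X p q a v; rewrite /= /linear_fun linearD /=.
by congr (_ + _); rewrite linearZ.
Qed.

Lemma lin_dE X p q a v : act (lin_d X p q) a v = p *: v + q *: d X a v.
Proof. by []. Qed.

Lemma lin_d_cmp X p q p' q' :
  lin_d X p q \c lin_d X p' q' = lin_d X (p * p' + q * q' * t) (p * q' + q * p').
Proof.
apply: act_inj => a v; rewrite act_cmp !lin_dE.
have -> : d X a (p' *: v + q' *: d X a v) = p' *: d X a v + (q' * t) *: v.
  have L k (w : base X a) : d X a (k *: w) = k *: d X a w by exact: linearZ.
  by rewrite [LHS](linearD (d X a)) !L F_sq scalerA.
rewrite !scalerDr !scalerDl !scalerA -!addrA mulrA; congr (_ + _).
by rewrite addrA addrC.
Qed.

Lemma lin_d1 X : lin_d X 1 0 = idm X.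
Proof. by apply: act_inj => a v; rewrite lin_dE scale1r scale0r addr0. Qed.

Lemma lin_d_compl X p q : idm X - lin_d X p q = lin_d X (1 - p) (- q).
Proof.
apply: act_inj => a v; rewrite actB !lin_dE act_id.
by rewrite scalerBl scale1r scaleNr opprD addrA.
Qed.

(** The coefficients of p + q d acting on E(x, x + theta) are read off from the
    image p e_x + q d e_x of the first generator. *)
Lemma lin_d_coefficients x p q : (p, q) =
  (act (lin_d (Ec x) p q) _ (gx x) false,
   act (lin_d (Ec x) p q) _ (gx x) true) :> R * R.
Proof.
have e1 a b alpha (h : arc a b alpha) : alpha < tau Re -> e_ t h = 1 :> R.
  by move=> lt; rewrite /e_ turns0 ?expr0 // lt andbT; case/andP: h.
have gxE : gx x false = 1 :> R by rewrite [LHS]dsum_inE e1 ?tau_gt0.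
have dgx0 : d (Ec x) _ (gx x) false = 0.
  by rewrite [LHS]E_d_false [gx x true]dsum_in_ne // linear0.
have dgx1 : d (Ec x) _ (gx x) true = 1 :> R.
  rewrite [LHS]E_d_true [gx x false]dsum_inE [LHS]P_homE e1 //.
  by have := c_gt0; have := theta_gt0; have := c_theta; rewrite /tau; lra.
rewrite !lin_dE; congr (_, _).
  transitivity (p * (gx x false : R) + q * (d (Ec x) _ (gx x) false : R)) => //.
  by rewrite gxE dgx0 mulr0 addr0 mulr1.
transitivity (p * (gx x true : R) + q * (d (Ec x) _ (gx x) true : R)) => //.
by rewrite dgx1 mulr1 [gx x true]dsum_in_ne // mulr0 add0r.
Qed.

(** The value of E(x, x + theta) at [x] is free on e_x and d e_x; therefore its
    endomorphism ring is R[d] / (d^2 - t). *)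
Lemma Ec_end x (f : mor (Ec x) (Ec x)) : exists p q, f = lin_d (Ec x) p q.
Proof.
exists (act f _ (gx x) false), (act f _ (gx x) true); apply: hom_from_Ec_inj.
set p : R := act f _ _ _; set q : R := act f _ _ _.
case: (lin_d_coefficients x p q) => pE qE.
by apply: dsum_ext => -[]; [apply: qE|apply: pE].
Qed.

(** The inverse of p + q d is (p - q d) / n, where n = p^2 - q^2 t is the norm; it
    is a unit if p is, because t is not. *)
Lemma Ec_local x : local_object (Ec x).
Proof.
have [t0 tN _] := tP.
have tC w : 1 - w * t \is a GRing.unit.
  have /orP[wt|] := uniformizing_local tP (w * t); last by [].
  by move: wt; rewrite unitrM (negPf tN) andbF.
have iso p q : p \is a GRing.unit -> is_iso (lin_d (Ec x) p q).
  move=> pu; pose n := p * p - q * q * t.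
  have nu : n \is a GRing.unit.
    have -> : n = p * p * (1 - (q / p) * (q / p) * t).
      rewrite mulrBr mulr1 /n; congr (_ - _).
      by rewrite -[in LHS](divrK pu q); ring.
    by rewrite unitrM tC unitrM pu.
  exists (lin_d (Ec x) (p / n) (- q / n)); rewrite !lin_d_cmp -!lin_d1.
  have E1 : p / n * p + - q / n * q * t = 1 by rewrite -(divrr nu) {3}/n; ring.
  have E0 : p / n * q + - q / n * p = 0 by ring.
  split; congr lin_d; [exact: E1|exact: E0|rewrite -[RHS]E1|rewrite -[RHS]E0]; ring.
move=> f; have [p [q ->]] := Ec_end f; rewrite lin_d_compl.
by have [pu|pu] := orP (uniformizing_local tP p); [left|right]; apply: iso.
Qed.

(** If p + q d is idempotent, then p^2 + q^2 t = p and 2 p q = q.  If q is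
    nonzero, then 2 p = 1, and four times the first equation makes t a unit. *)
Lemma Ec_idempotent x (e : mor (Ec x) (Ec x)) : e \c e = e -> e = 0 \/ e = idm _.
Proof.
have [t0 tN _] := tP.
have [p [q ->]] := Ec_end e; rewrite lin_d_cmp => ee.
have [pE qE] : p * p + q * q * t = p /\ p * q + q * p = q.
  have := lin_d_coefficients x (p * p + q * q * t) (p * q + q * p).
  by rewrite ee -lin_d_coefficients => -[].
have [q0|q0] := eqVneq q 0.
  have /eqP : p * (1 - p) = 0 by rewrite mulrBr mulr1 -{1}pE q0; ring.
  rewrite q0 mulf_eq0 subr_eq0 => /orP[/eqP->|/eqP <-]; last by right; apply: lin_d1.
  by left; apply: act_inj => a v; rewrite lin_dE !scale0r addr0.
have p2 : 2 * p = 1.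
  apply: (mulfI q0); rewrite mulr1 -[RHS]qE; ring.
(* 4 t q^2 = 4 p - 4 p^2 = 2 - 1. *)
case/negP: tN; apply/unitrPr; exists (4 * (q * q)).
have -> : t * (4 * (q * q)) = 2 * (2 * p) - 2 * p * (2 * p).
  by rewrite -[X in 2 * (2 * X)]pE; ring.
by rewrite p2; ring.
Qed.

Lemma Ec_indecomposable x : indecomposable (Ec x).
Proof.
have nz : idm (Ec x) <> 0.
  move=> /act_eq /(_ _ (gx x)) /(congr1 (fun v : base (Ec x) _ => v false)).
  rewrite [LHS]dsum_inE /e_ turns0 ?lexx ?tau_gt0 // expr0 => /eqP.
  by apply/negP/oner_neq0.
split=> // A B [i1 [i2 [p1 [p2 [p1i1 p2i2 p1i2 p2i1 sum1]]]]].
have [|e0|e1] := @Ec_idempotent x (i1 \c p1).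
- by rewrite cmpA -(cmpA i1) p1i1 cmpm1.
- left; rewrite /is_zero -p1i1 -[p1]cmp1m -p1i1 -(cmpA p1) e0.
  by rewrite cmpm0 cmp0m.
right; have e2 : i2 \c p2 = 0 by apply: (addrI (i1 \c p1)); rewrite sum1 e1 addr0.
by rewrite /is_zero -p2i2 -[p2]cmp1m -p2i2 -(cmpA p2) e2 cmpm0 cmp0m.
Qed.

(** X is a retract of a sum of objects with local endomorphism rings, so it is
    itself a sum of such objects; being indecomposable, it is one of them. *)
Lemma projective_indecomposable (X : C) :
  indecomposable X -> projective_object ex X -> exists x, isomorphic X (Ec x).
Proof.
move=> [X0 Xind] /projective_retract [I [x [i [p pi]]]].
have [||J [k [a [b [ba _ ab]]]]] := local_decomposition
  (F_c_idempotents_split tP theta_ge0) _ (s := index_enum I)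
  (E := fun j => Ec (x j))
  (g := fun j => p \c sum_in tP theta_ge0 _ j)
  (h := fun j => sum_out tP theta_ge0 _ j \c i).
- by move=> j; apply: Ec_local.
- rewrite -pi -[p in RHS]cmpm1 -sum_id cmp_sumr cmp_suml.
  by apply: eq_bigr => j _; rewrite !cmpA.
have [j _|noJ] := pickP (fun _ : J => true); last first.
  by case: X0; rewrite /is_zero -ab big1 // => j; have := noJ j.
have [Z [z [r bi]]] :=
  complement_of_retract (F_c_idempotents_split tP theta_ge0) (ba j).
exists (x (k j)); apply: isomorphic_sym; exists (a j), (b j); split=> //.
have [|E0|Z0] := Xind (Ec (x (k j))) Z; first by exists (a j), z, (b j), r.
  by case: (Ec_indecomposable (x (k j))).
have [_ _ _ _ <-] := bi; have -> : z = 0 by rewrite -[z]cmpm1 [idm Z]Z0 cmpm0.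
by rewrite cmp0m addr0.
Qed.

End Frobenius.

Theorem corollary2p4p5 (Re : realType) (R : idomainType)
    (nu : {fraction R} -> int) (t : R) (c theta : Re)
    (R_dvr : is_dvr nu) (t_unif : uniformizer nu t)
    (c_gt0 : 0 < c) (theta_gt0 : 0 < theta) (c_theta : c + theta = pi) :
  let exact := @F_c_exact Re R t theta in
  let E1 (x : Re) := E t x (x + theta) (E_range c_gt0 theta_gt0 c_theta x) in
  let E2 (x : Re) := E t (x + theta) (x + tau Re)
                  (E_range' c_gt0 theta_gt0 c_theta x) in
  frobenius exact /\
  exists (h1 : forall x, in_F_c theta (E1 x))
         (h2 : forall x, in_F_c theta (E2 x)),
    let E1c x : F_c t theta := exist _ (E1 x) (h1 x) in
    let E2c x : F_c t theta := exist _ (E2 x) (h2 x) in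
    (forall x, isomorphic (E1c x) (E2c x)) /\
    (forall X : F_c t theta,
       [/\ indecomposable X, projective_object exact X & injective_object exact X] <->
       exists x, isomorphic X (E1c x)).
Proof.
have tP := dvr_uniformizing R_dvr t_unif.
move=> exact E1 E2; split; first exact: (F_c_frobenius tP c_gt0 theta_gt0 c_theta).
exists (E1_in_F_c tP c_gt0 theta_gt0 c_theta).
exists (E2_in_F_c tP c_gt0 theta_gt0 c_theta).
move=> E1c E2c; split=> [x|X].
  by have [f fiso] := E_swap t (E_range c_gt0 theta_gt0 c_theta x)
    (E_range' c_gt0 theta_gt0 c_theta x) erefl; exists f.
split=> [[Xind Xproj _]|[x XE]].
  exact: (projective_indecomposable tP c_gt0 theta_gt0 c_theta Xind Xproj).
split.
- by apply: isomorphic_indecomposable XE _; apply: Ec_indecomposable.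
- by apply: retract_projective (isomorphic_retract XE) _; apply: Ec_projective.
- by apply: retract_injective (isomorphic_retract XE) _; apply: Ec_injective.
Qed.
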